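(* Suppose $\Omega=\mathrm{conv}(v_1,\dots,v_m)$ is an $n$-dimensional compact convex polytope in $\mathbf{R}^n$ such that $v_i\notin\mathrm{conv}(v_1,\dots,v_{i-1},v_{i+1},\dots,v_m)$ for all $i$, and $p_1,\dots,p_k$ are distinct points in the interior of $\Omega$. Then for any $g_1,\dots,g_m\in\mathbf{R}$ and $A_1,\dots,A_k>0$, there exist a convex cell decomposition $\mathcal{T}$ of $\Omega$ having all the $v_i$ and $p_j$ as vertices and a piecewise linear convex function $w:(\Omega,\mathcal{T})\to\mathbf{R}$ (linear on each cell of $\mathcal{T}$) such that $w(v_i)=g_i$ for $i=1,\dots,m$ and the discrete Hessian determinant of $w$ at $p_j$ is $A_j$ for $j=1,\dots,k$. In fact, the solution $w$ is the Legendre dual of $$\max\{x\cdot p_j+h_j,\ x\cdot v_i-g_i \mid j=1,\dots,k,\ i=1,\dots,m\},$$ and $h=(h_1,\dots,h_k)$ is the unique critical point of a strictly convex function.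
   Context: $\mathrm{conv}$ denotes convex hull, and $x\cdot y$ is the dot product in $\mathbf{R}^n$. A convex cell decomposition (convex subdivision) of a convex polyhedron $K$ is a collection $\mathcal{T}$ of convex polyhedra (cells) such that (a) $K=\bigcup_{\sigma\in\mathcal{T}}\sigma$; (b) if $\sigma,\tau\in\mathcal{T}$ then $\sigma\cap\tau\in\mathcal{T}$; (c) if $\sigma\in\mathcal{T}$ and $\tau\subset\sigma$, then $\tau\in\mathcal{T}$ if and only if $\tau$ is a face of $\sigma$. Its vertices are its zero-dimensional cells. Discrete Hessian determinant: if $w$ is a convex function on a domain in $\mathbf{R}^n$ that is linear on each cell of a convex cell decomposition $\mathcal{T}$, the discrete Hessian determinant of $w$ assigns to each vertex $v$ of $\mathcal{T}$ the volume of the convex hull of the gradients of $w$ at the top-dimensional cells of $\mathcal{T}$ adjacent to $v$. The Legendre(-Fenchel) dual of a function $f:\mathbf{R}^n\to(-\infty,\infty]$ that is not identically $\infty$ is $f^*(y)=\sup\{x\cdot y-f(x)\mid x\in\mathbf{R}^n\}$, with domain $\{y: f^*(y)<\infty\}$; for the maximum of affine functions in the claim, the domain of the dual is $\Omega$. *)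

(* Defs.v *)
(* Points of R^n are row vectors, elements of 'rV[R]_n. *)
From HB Require Import structures.
From mathcomp Require Import all_boot all_order all_algebra.
From mathcomp Require Import all_classical all_reals all_analysis.

Set Implicit Arguments.
Unset Strict Implicit.
Unset Printing Implicit Defensive.

Import Order.TTheory GRing.Theory Num.Theory.
Import numFieldNormedType.Exports.

Local Open Scope classical_set_scope.
Local Open Scope ring_scope.

Definition dot (R : realType) (n : nat) (x y : 'rV[R]_n) : R :=
  \sum_(i < n) x 0 i * y 0 i.

Definition convex_hull (R : realType) (n : nat) (S : set 'rV[R]_n) :
    set 'rV[R]_n :=
  smallest (@convex_set R 'rV[R]_n) S.

(* The universal property says that U is the span of the differences of points
   of S, i.e. the direction space of the affine hull of S. *)
Definition has_dim (R : realType) (n : nat) (S : set 'rV[R]_n) (d : nat) :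
    Prop :=
  S !=set0 /\
  exists2 U : {vspace 'rV[R]_n}, \dim U = d &
    forall V : {vspace 'rV[R]_n},
      (forall x y, S x -> S y -> x - y \in V) <-> (U <= V)%VS.

(* n-dimensional Lebesgue measure, as the iterated product of the Lebesgue
   measure on R: as in the library's product_measure1, the sections along the
   first coordinate are measured and the result is integrated. It is applied
   below to compact convex sets only, for which measurability is not an issue. *)
Fixpoint volume (R : realType) (n : nat) : set 'rV[R]_n -> \bar R :=
  match n return set 'rV[R]_n -> \bar R with
  | 0 => fun S => (\1_S 0)%:E
  | n'.+1 => fun S =>
      (\int[@lebesgue_measure R]_x
         volume [set y : 'rV[R]_n' | S (row_mx (x%:M : 'M[R]_1) y)])%E
  end.

Definition convex_polyhedron (R : realType) (n : nat) (P : set 'rV[R]_n) :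
    Prop :=
  exists (N : nat) (a : 'I_N -> 'rV[R]_n) (b : 'I_N -> R),
    P = [set x | forall i, dot (a i) x <= b i].

(* a = 0 is allowed, so P itself and the empty set are faces of P. *)
Definition face (R : realType) (n : nat) (F P : set 'rV[R]_n) : Prop :=
  exists (a : 'rV[R]_n) (b : R),
    (forall x, P x -> dot a x <= b) /\ F = P `&` [set x | dot a x = b].

(* Finiteness is tacit in the notion of a decomposition of a compact polytope;
   without it the set of all points of K, together with the empty set, would
   qualify. *)
Definition convex_cell_decomposition (R : realType) (n : nat)
    (K : set 'rV[R]_n) (T : set (set 'rV[R]_n)) : Prop :=
  [/\ finite_set T /\ (forall s, T s -> convex_polyhedron s),
      K = \bigcup_(s in T) s,
      forall s t, T s -> T t -> T (s `&` t)
    & forall s t, T s -> t `<=` s -> (T t <-> face t s)].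

Definition is_vertex (R : realType) (n : nat) (T : set (set 'rV[R]_n))
    (v : 'rV[R]_n) : Prop :=
  exists s, [/\ T s, has_dim s 0 & s v].

Definition piecewise_linear (R : realType) (n : nat)
    (T : set (set 'rV[R]_n)) (w : 'rV[R]_n -> R) : Prop :=
  forall s, T s -> exists (a : 'rV[R]_n) (b : R),
    forall x, s x -> w x = dot a x + b.

(* On an n-dimensional cell the slope a below is unique: it is the gradient. *)
Definition gradients_at (R : realType) (n : nat) (T : set (set 'rV[R]_n))
    (w : 'rV[R]_n -> R) (v : 'rV[R]_n) : set 'rV[R]_n :=
  [set a | exists (s : set 'rV[R]_n) (b : R),
     [/\ T s, has_dim s n, s v & forall x, s x -> w x = dot a x + b]].

Definition discrete_hessian_det (R : realType) (n : nat)
    (T : set (set 'rV[R]_n)) (w : 'rV[R]_n -> R) (v : 'rV[R]_n) : \bar R :=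
  volume (convex_hull (gradients_at T w v)).

Definition legendre (R : realType) (n : nat) (f : 'rV[R]_n -> \bar R)
    (y : 'rV[R]_n) : \bar R :=
  ereal_sup [set ((dot x y)%:E - f x)%E | x in [set: 'rV[R]_n]].

Definition legendre_domain (R : realType) (n : nat) (f : 'rV[R]_n -> \bar R) :
    set 'rV[R]_n :=
  [set y | (legendre f y < +oo)%E].

Definition max_affine (R : realType) (n m k : nat)
    (v : 'I_m -> 'rV[R]_n) (g : 'I_m -> R) (p : 'I_k -> 'rV[R]_n)
    (h : 'rV[R]_k) (x : 'rV[R]_n) : \bar R :=
  maxe (\big[maxe/-oo%E]_(j < k) (dot x (p j) + h 0 j)%:E)
       (\big[maxe/-oo%E]_(i < m) (dot x (v i) - g i)%:E).

Definition cell (R : realType) (n m k : nat)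
    (v : 'I_m -> 'rV[R]_n) (g : 'I_m -> R) (p : 'I_k -> 'rV[R]_n)
    (h : 'rV[R]_k) (j : 'I_k) : set 'rV[R]_n :=
  [set x | max_affine v g p h x = (dot x (p j) + h 0 j)%:E].

Definition admissible (R : realType) (n m k : nat)
    (v : 'I_m -> 'rV[R]_n) (g : 'I_m -> R) (p : 'I_k -> 'rV[R]_n) :
    set 'rV[R]_k :=
  [set h | forall j, (0 < volume (cell v g p h j))%E].

Definition strictly_convex (R : realType) (k : nat)
    (H : set 'rV[R]_k) (E : 'rV[R]_k -> R) : Prop :=
  convex_set (H : set (convex_lmodType 'rV[R]_k)) /\
  forall (x y : 'rV[R]_k) (t : R), H x -> H y -> x <> y -> 0 < t < 1 ->
    E (t *: x + (1 - t) *: y) < t * E x + (1 - t) * E y.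

(* E is the function of the variational principle, determined up to a constant
   by dE = \sum_j (vol (cell h j) - A j) dh_j on the admissible set. *)
Definition variational_function (R : realType) (n m k : nat)
    (v : 'I_m -> 'rV[R]_n) (g : 'I_m -> R) (p : 'I_k -> 'rV[R]_n)
    (A : 'I_k -> R) (E : 'rV[R]_k -> R) : Prop :=
  forall h, admissible v g p h ->
    is_diff h E
      (fun u => \sum_(j < k) (fine (volume (cell v g p h j)) - A j) * u 0 j).

Definition critical_point (R : realType) (k : nat)
    (H : set 'rV[R]_k) (E : 'rV[R]_k -> R) (h : 'rV[R]_k) : Prop :=
  H h /\ is_diff h E (fun=> 0).

(* Main.v *)
(* Let phi h be the maximum of the affine functions in the theorem and phiv the
   maximum of those that come from the v_i.  As every p_j is interior to Omega,
   phi h - phiv has compact support, and F h = \int (phi h - phiv) is a convex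
   function of h whose partial derivative in h_j is the volume of the cell of
   p_j.  The function E h = F h - \sum_j A_j h_j is coercive: F grows faster than
   any multiple of h_j as h_j -> +oo, and F >= 0 otherwise.  At its minimum the
   cell volumes are the A_j.  On the set where all cells are nondegenerate E is
   strictly convex.

   The decomposition T consists of the sets sigma x = conv of the points whose
   affine function is active at x, that is, of the projections of the lower faces
   of the convex hull of the points (p_j, -h_j), (v_i, g_i).  Weyl's theorem shows
   that these sets are polyhedra covering Omega, and that sigma x is the set where
   the Legendre dual w satisfies w y = x.y - phi h x.  The slope of w on sigma x is
   x, so the gradients of w at p_j are the vertices of the cell of p_j. *)

Require Import Defs.
From HB Require Import structures.
From mathcomp Require Import all_boot all_order all_algebra.
From mathcomp Require Import all_classical all_reals all_analysis.
From mathcomp Require Import measurable_realfun ring lra.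

Import Order.TTheory GRing.Theory Num.Theory.
Import numFieldNormedType.Exports.

Local Open Scope classical_set_scope.
Local Open Scope ring_scope.
Set Implicit Arguments.
Unset Strict Implicit.
Unset Printing Implicit Defensive.

(** The minimum of E is sought over all of R^k and not over the admissible set. E is differentiable
    on all of R^k, so no boundary has to be treated: the vanishing differential makes the cell
    volumes equal to the A_j, and as these are positive the minimizer turns out to be admissible.
    Conversely, convexity on R^k makes every critical point a global minimizer, and two of them
    would contradict strict convexity at their midpoint.

    Differentiability comes from a pointwise estimate: phi (h + u) - phi h equals u_j on the cell of
    p_j and 0 off these cells, except in thin slabs around the hyperplanes where two of the affine
    functions agree, and the volume of the slabs tends to 0 with their width.

    On the dual side, cells are handled through the equality case of Fenchel's inequality: two cells
    that meet do so in the cell of the midpoint of their slopes, and a face is obtained by tilting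
    the slope a little. *)

Section Dot.
Variables (R : realType) (n : nat).
Implicit Types (x y z : 'rV[R]_n) (t : R).

Lemma dotC x y : dot x y = dot y x.
Proof. by apply: eq_bigr => i _; rewrite mulrC. Qed.

Lemma dotDl x y z : dot (x + y) z = dot x z + dot y z.
Proof. by rewrite -big_split; apply: eq_bigr => i _; rewrite mxE mulrDl. Qed.

Lemma dotDr x y z : dot x (y + z) = dot x y + dot x z.
Proof. by rewrite dotC dotDl !(dotC x). Qed.

Lemma dotZl t x y : dot (t *: x) y = t * dot x y.
Proof. by rewrite mulr_sumr; apply: eq_bigr => i _; rewrite mxE mulrA. Qed.

Lemma dotZr t x y : dot x (t *: y) = t * dot x y.
Proof. by rewrite dotC dotZl dotC. Qed.

Lemma dotNl x y : dot (- x) y = - dot x y.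
Proof. by rewrite -scaleN1r dotZl mulN1r. Qed.

Lemma dotNr x y : dot x (- y) = - dot x y.
Proof. by rewrite dotC dotNl dotC. Qed.

Lemma dotBl x y z : dot (x - y) z = dot x z - dot y z.
Proof. by rewrite dotDl dotNl. Qed.

Lemma dotBr x y z : dot x (y - z) = dot x y - dot x z.
Proof. by rewrite dotDr dotNr. Qed.

Lemma dot0l x : dot 0 x = 0.
Proof. by rewrite -(scale0r 0) dotZl mul0r. Qed.

Lemma dot0r x : dot x 0 = 0.
Proof. by rewrite dotC dot0l. Qed.

Lemma dot_sumr (I : Type) (r : seq I) (P : pred I) (F : I -> 'rV[R]_n) x :
  dot x (\sum_(i <- r | P i) F i) = \sum_(i <- r | P i) dot x (F i).
Proof. exact: (big_morph (dot x) (dotDr x) (dot0r x)). Qed.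

Lemma dot_delta x i : dot (delta_mx 0 i) x = x 0 i.
Proof.
rewrite /dot (bigD1 i) //= mxE !eqxx mul1r big1 ?addr0 // => j ji.
by rewrite mxE (negbTE ji) andbF mul0r.
Qed.

Lemma dot_eq0 x : (dot x x == 0) = (x == 0).
Proof.
apply/eqP/eqP => [x0|->]; last by rewrite dot0r.
apply/rowP => i; rewrite mxE; apply/eqP; rewrite -sqrf_eq0 expr2.
by rewrite (psumr_eq0P _ x0) // => j _; exact: sqr_ge0.
Qed.

End Dot.

(** * Weyl's theorem *)

Section Weyl.
Variables (R : realType) (d : nat).
Implicit Types (x u a b : 'rV[R]_d) (L : seq 'rV[R]_d).

Fixpoint in_cone L x : Prop :=
  if L is u :: L' then exists2 t : R, 0 <= t & in_cone L' (x - t *: u)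
  else x = 0.

Lemma eq0_dual_cone : exists A : seq 'rV[R]_d,
  forall x, x = 0 <-> forall a, a \in A -> dot a x <= 0.
Proof.
exists ([seq delta_mx 0 i | i <- enum 'I_d] ++
        [seq - delta_mx 0 i | i <- enum 'I_d]) => x.
split=> [-> a _|xA]; first by rewrite dot0r.
apply/rowP => i; rewrite mxE; apply/eqP; rewrite eq_le.
have -> : x 0 i <= 0.
  rewrite -dot_delta xA // mem_cat; apply/orP; left.
  by apply/mapP; exists i; rewrite ?mem_enum.
rewrite -oppr_le0 -dot_delta -dotNl xA // mem_cat; apply/orP; right.
by apply/mapP; exists i; rewrite ?mem_enum.
Qed.

(* Fourier-Motzkin elimination of the coefficient of one generator. *)
Lemma dual_cone_cons (A : seq 'rV[R]_d) u : exists B : seq 'rV[R]_d,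
  forall x, (exists2 t : R, 0 <= t & forall a, a \in A -> dot a (x - t *: u) <= 0)
    <-> forall b, b \in B -> dot b x <= 0.
Proof.
pose N := [seq a <- A | dot a u <= 0].
pose P := [seq a <- A | 0 < dot a u].
exists (N ++ [seq (- dot b u) *: a + dot a u *: b | a <- P, b <- N]) => x.
split=> [[t t0 xt] b|xB].
  rewrite mem_cat => /orP[|/allpairsP[[a b']]].
    rewrite mem_filter => /andP[bu bA]; have := xt _ bA.
    rewrite dotBr dotZr; nra.
  rewrite /= !mem_filter => -[/andP[au aA] /andP[bu bA] ->].
  have := xt _ aA; have := xt _ bA; rewrite !dotBr !dotZr dotDl !dotZl; nra.
have xN a : a \in N -> dot a x <= 0 by move=> aN; apply: xB; rewrite mem_cat aN.
have xPN a b : a \in P -> b \in N -> - dot b u * dot a x + dot a u * dot b x <= 0.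
  move=> aP bN; rewrite -!dotZl -dotDl; apply: xB.
  by rewrite mem_cat; apply/orP; right; apply/allpairsP; exists (a, b).
(* Rows of [P] bound the coefficient from below; [t] is the least nonnegative value that satisfies
   them all. The rows of [N] are then checked against it. *)
pose t := \big[Num.max/0]_(a <- P) (dot a x / dot a u).
have t0 : 0 <= t by exact: bigmax_ge_id.
exists t => // a aA; rewrite dotBr dotZr.
have [au|au] := ltP 0 (dot a u).
  have aP : a \in P by rewrite mem_filter au.
  suff : dot a x / dot a u <= t by rewrite ler_pdivrMr // subr_le0.
  exact: (@le_bigmax_seq _ _ _ _ _ a xpredT (fun a => dot a x / dot a u) aP).
have aN : a \in N by rewrite mem_filter au.
rewrite subr_le0.
(* If a row [b] attains the maximum, the combination of [b] with [a] gives the bound; at the default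
   0 the row [a] itself does. *)
have [[b bP ->]|->] : (exists2 b, b \in P & t = dot b x / dot b u) \/ t = 0.
- rewrite /t; elim: (P) => [|b P' IH]; first by rewrite big_nil; right.
  rewrite big_cons maxEle; case: ifP => _.
    case: IH => [[c cP ->]|->]; [left|by right].
    by exists c => //; rewrite inE cP orbT.
  by left; exists b => //; rewrite inE eqxx.
- have bu : 0 < dot b u by move: bP; rewrite mem_filter => /andP[].
  rewrite mulrAC ler_pdivlMr //; have := xPN _ _ bP aN; lra.
- by rewrite mul0r xN.
Qed.

Lemma in_cone_dual L : exists A : seq 'rV[R]_d,
  forall x, in_cone L x <-> forall a, a \in A -> dot a x <= 0.
Proof.
elim: L => [|u L [A LA]]; first exact: eq0_dual_cone.
have [B AB] := dual_cone_cons A u; exists B => x; rewrite -AB /=.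
by split=> -[t t0 xt]; exists t => //; apply/LA.
Qed.

Lemma in_cone_map (I : eqType) (u : I -> 'rV[R]_d) (s : seq I) x : uniq s ->
  in_cone [seq u i | i <- s] x <->
  exists2 l : I -> R, forall i, 0 <= l i & x = \sum_(i <- s) l i *: u i.
Proof.
elim: s x => [|i s IH] x /=.
  split=> [->|[l _]]; last by rewrite big_nil.
  by exists (fun=> 0); rewrite ?big_nil.
move=> /andP[iNs us]; split=> [[t t0 /IH[//|l l0 xl]]|[l l0 xl]].
  exists (fun j => if j == i then t else l j) => [j|]; first by case: ifP.
  rewrite big_cons eqxx; apply/eqP; rewrite addrC -subr_eq xl; apply/eqP.
  rewrite !big_seq; apply: eq_bigr => j js.
  by case: eqP => // ji; rewrite -ji js in iNs.
exists (l i) => //; apply/IH => //; exists l => //.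
by rewrite xl big_cons addrAC subrr add0r.
Qed.

Theorem weyl (I : finType) (u : I -> 'rV[R]_d) : exists A : seq 'rV[R]_d,
  forall x, (exists2 l : I -> R, forall i, 0 <= l i & x = \sum_i l i *: u i) <->
    forall a, a \in A -> dot a x <= 0.
Proof.
have [A LA] := in_cone_dual [seq u i | i <- index_enum I].
by exists A => x; rewrite -LA in_cone_map // index_enum_uniq.
Qed.

End Weyl.

Section Homogenization.
Variables (R : realType) (n : nat).
Implicit Types (x y : 'rV[R]_n) (s t : R).

(** The lift to height [s]: affine conditions on [y] become linear conditions on [homog y 1], so
    that facts about cones apply to polytopes. *)
Definition homog y s : 'rV[R]_(n + 1) := row_mx y s%:M.

Lemma dot_homog x y s t : dot (homog x s) (homog y t) = dot x y + s * t.
Proof.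
rewrite /dot big_split_ord /= big_ord1 !row_mxEr !mxE /= !mulr1n.
by congr (_ + _); apply: eq_bigr => i _; rewrite !row_mxEl.
Qed.

Lemma homogD x y s t : homog x s + homog y t = homog (x + y) (s + t).
Proof. by rewrite /homog add_row_mx raddfD. Qed.

Lemma homogZ (l : R) x s : l *: homog x s = homog (l *: x) (l * s).
Proof. by rewrite /homog scale_row_mx scale_scalar_mx. Qed.

Lemma sum_homog (I : finType) (l : I -> R) (q : I -> 'rV[R]_n) (c : I -> R) :
  \sum_i l i *: homog (q i) (c i) =
  homog (\sum_i l i *: q i) (\sum_i l i * c i).
Proof.
apply/rowP => j; rewrite summxE; case: (split_ordP j) => i ->.
  by rewrite row_mxEl summxE; apply: eq_bigr => k _; rewrite mxE row_mxEl mxE.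
rewrite row_mxEr !ord1 mxE mulr1n; apply: eq_bigr => k _.
by rewrite mxE row_mxEr mxE mulr1n.
Qed.

Lemma homog_inj x y s t : homog x s = homog y t -> x = y /\ s = t.
Proof.
move=> /eq_row_mx[-> /matrixP/(_ 0 0)]; rewrite !mxE !mulr1n.
by split.
Qed.

Lemma homogP (a : 'rV[R]_(n + 1)) : exists x s, a = homog x s.
Proof.
exists (lsubmx a), (rsubmx a 0 0).
by rewrite /homog -[a in LHS]hsubmxK [rsubmx a in LHS]mx11_scalar.
Qed.

End Homogenization.

(** * Convex hulls and polytopes *)

Section Hull.
Variables (R : realType) (n : nat) (I : finType).
Implicit Types (q : I -> 'rV[R]_n) (P : pred I) (y : 'rV[R]_n).

(** The coefficients live on all of [I] and vanish off [P], so hulls over different [P] share one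
    index type. *)
Definition hull q P : set 'rV[R]_n := [set y | exists l : I -> R,
  [/\ forall i, 0 <= l i, forall i, ~~ P i -> l i = 0, \sum_i l i = 1 &
      \sum_i l i *: q i = y]].

(** A point lies in the hull exactly when its lift to height 1 lies in the cone over the lifted
    generators, to which [weyl] applies; generators off [P] are replaced by 0. *)
Lemma hull_polyhedron q P : convex_polyhedron (hull q P).
Proof.
have [A qA] := weyl (fun i => if P i then homog (q i) 1 else 0).
exists (size A), (fun i => lsubmx (tnth (in_tuple A) i)),
  (fun i => - rsubmx (tnth (in_tuple A) i) 0 0).
have dotA a y : dot a (homog y 1) = dot (lsubmx a) y + rsubmx a 0 0.
  have [x [s ->]] := homogP a.
  by rewrite dot_homog mulr1 row_mxKl row_mxKr mxE mulr1n.
have hA y : hull q P y <-> forall a, a \in A -> dot a (homog y 1) <= 0.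
  rewrite -qA; split=> [[l [l0 lP l1 ly]]|[l l0 yl]].
    exists l => //; rewrite -ly.
    transitivity (\sum_i l i *: homog (q i) 1).
      rewrite sum_homog; congr homog; rewrite -[LHS]l1.
      by apply: eq_bigr => i _; rewrite mulr1.
    apply: eq_bigr => i _; case: ifP => // /negbT iP.
    by rewrite (lP _ iP) !scale0r.
  pose l' i := if P i then l i else 0.
  have : homog y 1 = \sum_i l' i *: homog (q i) 1.
    rewrite yl; apply: eq_bigr => i _; rewrite /l'.
    by case: ifP => _; rewrite ?scaler0 ?scale0r.
  rewrite sum_homog => /homog_inj[-> l1]; exists l'; split => //.
  - by move=> i; rewrite /l'; case: ifP.
  - by move=> i; rewrite /l'; case: ifP.
  - by rewrite l1; apply: eq_bigr => i _; rewrite mulr1.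
rewrite eqEsubset; split=> y /=.
  by move=> /hA yA i; rewrite -subr_le0 opprK -dotA yA // mem_tnth.
move=> yA; apply/hA => a /(tnthP (in_tuple A))[i ->].
by rewrite dotA -[rsubmx _ _ _]opprK subr_le0.
Qed.

Lemma hull_pt q P i : P i -> hull q P (q i).
Proof.
move=> Pi; exists (fun j => (j == i)%:R); split=> [j|j|| ].
- by rewrite ler0n.
- by case: eqP => // ->; rewrite Pi.
- by rewrite (bigD1 i) //= eqxx big1 ?addr0 // => j /negbTE ->.
- rewrite (bigD1 i) //= eqxx scale1r big1 ?addr0 // => j /negbTE ->.
  by rewrite scale0r.
Qed.

(** Any inequality of the polyhedral description that [y] violates separates. *)
Lemma hull_separation q P y : ~ hull q P y ->
  exists a b, (forall i, P i -> dot a (q i) <= b) /\ b < dot a y.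
Proof.
move=> ny; have [N [a [b qE]]] := hull_polyhedron q P.
have [k ky] : exists k, b k < dot (a k) y.
  apply/not_existsP => nk; apply: ny; rewrite qE => k.
  by have /negP := nk k; rewrite -leNgt.
exists (a k), (b k); split=> // i Pi.
by have := hull_pt q Pi; rewrite qE; apply.
Qed.

Lemma hull_sub q P P' : (forall i, P i -> P' i) -> hull q P `<=` hull q P'.
Proof.
move=> PP' y [l [l0 lP l1 ly]]; exists l; split => // i P'i.
by apply: lP; apply: contra P'i; exact: PP'.
Qed.

Lemma hull_conv q P x y (t : R) : 0 <= t <= 1 -> hull q P x -> hull q P y ->
  hull q P (t *: x + (1 - t) *: y).
Proof.
move=> /andP[t0 t1] [l [l0 lP l1 lx]] [k [k0 kP k1 ky]].
exists (fun i => t * l i + (1 - t) * k i); split=> [i|i Pi||].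
- by rewrite addr_ge0 ?mulr_ge0 ?subr_ge0.
- by rewrite lP // kP // !mulr0 addr0.
- by rewrite big_split /= -!mulr_sumr l1 k1 !mulr1 addrC subrK.
- rewrite -lx -ky !scaler_sumr -big_split /=; apply: eq_bigr => i _.
  by rewrite scalerDl !scalerA.
Qed.

Lemma hull_dot_le q P (a : 'rV[R]_n) (b : R) y :
  (forall i, P i -> dot a (q i) <= b) -> hull q P y -> dot a y <= b.
Proof.
move=> ab [l [l0 lP l1 <-]]; rewrite dot_sumr -[b]mul1r -l1 mulr_suml.
apply: ler_sum => i _; rewrite dotZr.
have [Pi|/lP ->] := boolP (P i); last by rewrite !mul0r.
by rewrite ler_wpM2l // ab.
Qed.

End Hull.

Section ConvexSets.
Variables (R : realType) (n : nat).
Implicit Types (S C : set 'rV[R]_n).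

Lemma convex_setE S : @convex_set R 'rV[R]_n S <->
  forall x y (t : R), 0 <= t <= 1 -> S x -> S y -> S (t *: x + (1 - t) *: y).
Proof.
split=> [cS x y t /andP[t0 t1] /mem_set Sx /mem_set Sy|cS x y t].
  by have /set_mem := cS x y (Itv01 t0 t1) Sx Sy.
rewrite !inE => Sx Sy; apply: cS => //.
by rewrite ge0 le1.
Qed.

Lemma convex_hull_min S C :
  @convex_set R 'rV[R]_n C -> S `<=` C -> convex_hull S `<=` C.
Proof. by move=> cC SC x /(_ C); apply. Qed.

Lemma sub_convex_hull S : S `<=` convex_hull S.
Proof. by move=> x Sx C [_]; apply. Qed.

Lemma convex_hull_convex S : @convex_set R 'rV[R]_n (convex_hull S).
Proof.
apply/convex_setE => x y t t01 hx hy C [cC SC].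
by have /convex_setE := cC; apply => //; [apply: hx|apply: hy].
Qed.

Lemma hull_convex (I : finType) (q : I -> 'rV[R]_n) (P : pred I) :
  @convex_set R 'rV[R]_n (hull q P).
Proof. by apply/convex_setE => x y t; exact: hull_conv. Qed.

Lemma convex_set_sum C (I : finType) (q : I -> 'rV[R]_n) (l : I -> R) :
  @convex_set R 'rV[R]_n C -> (forall i, 0 <= l i) -> \sum_i l i = 1 ->
  (forall i, l i != 0 -> C (q i)) -> C (\sum_i l i *: q i).
Proof.
move=> /convex_setE cC l0 l1 Cq.
(* The weights along a sublist need not add up to 1, so the induction is about renormalized
   barycenters of nonzero total weight. *)
suff cl (s : seq I) : let L := \sum_(i <- s) l i in
    L != 0 -> C (L^-1 *: \sum_(i <- s) l i *: q i).
  by have := cl (index_enum I); rewrite /= l1 invr1 scale1r; apply; exact: oner_neq0.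
elim: s => /= [|i s IH]; first by rewrite big_nil eqxx.
rewrite !big_cons; have [li|li] := eqVneq (l i) 0.
  by rewrite li scale0r !add0r.
set L := \sum_(j <- s) l j; have L0 : 0 <= L by apply: sumr_ge0.
have li0 : 0 < l i by rewrite lt_neqAle eq_sym li l0.
have [Lz _|Lz _] := eqVneq L 0.
  rewrite Lz [\sum_(j <- s) l j *: q j]big1_seq => [|j /= js].
    by rewrite !addr0 scalerA mulVf // scale1r; exact: Cq.
  have /eqP := Lz; rewrite psumr_eq0 // => /allP/(_ j js)/= /eqP ->.
  by rewrite scale0r.
have LL : 0 < l i + L by rewrite ltr_wpDr.
have := cC (q i) (L^-1 *: \sum_(j <- s) l j *: q j) (l i / (l i + L)).
have -> : 1 - l i / (l i + L) = L / (l i + L) by field; rewrite gt_eqF.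
rewrite [X in _ -> _ -> _ -> C (_ + X)]scalerA mulrAC divff // mul1r.
rewrite scalerDr scalerA [l i / _]mulrC; apply.
- by rewrite mulrC divr_ge0 ?(ltW LL) //= ler_pdivrMr // mul1r lerDl.
- exact: Cq.
- exact: IH.
Qed.

Lemma hull_convex_hull (I : finType) (q : I -> 'rV[R]_n) (P : pred I) :
  hull q P = convex_hull [set q i | i in [set i | P i]].
Proof.
rewrite eqEsubset; split=> [y [l [l0 lP l1 <-]]|].
  apply: convex_set_sum => // [|i li]; first exact: convex_hull_convex.
  apply: sub_convex_hull; exists i => //=.
  by apply: contraNT li => /lP ->.
apply: convex_hull_min; first exact: hull_convex.
by move=> _ [i Pi <-]; exact: hull_pt.
Qed.

(** This is the form in which full dimension makes slopes unique. A proper subspace containing all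
    differences has a nonzero normal; conversely, if the differences span, the kernel of [dot z]
    contains [z] itself. *)
Lemma has_dim_full S : has_dim S n <-> S !=set0 /\
  forall z, (forall x y, S x -> S y -> dot z (x - y) = 0) -> z = 0.
Proof.
have dimn : \dim (fullv : {vspace 'rV[R]_n}) = n.
  by rewrite dimvf /dim /= mul1n.
split=> -[S0].
  move=> [U Un UV]; split=> // z zS.
  pose V := lker (linfun (mulmxr z^T) : 'Hom('rV[R]_n, 'rV[R]_1)).
  have VE x : x \in V <-> dot z x = 0.
    rewrite memv_ker lfunE /= dotC; split=> [/eqP/matrixP/(_ 0 0)|x0].
      by rewrite !mxE => <-; apply: eq_bigr => i _; rewrite mxE.
    apply/eqP/matrixP => i j; rewrite !ord1 !mxE -[RHS]x0.
    by apply: eq_bigr => k _; rewrite mxE.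
  have /UV : forall x y, S x -> S y -> x - y \in V.
    by move=> x y Sx Sy; apply/VE/zS.
  have -> : U = fullv by apply/eqP; rewrite eqEdim subvf Un dimn leqnn.
  by move=> /subvP/(_ z (memvf _))/VE/eqP; rewrite dot_eq0 => /eqP.
move=> S1; split=> //; exists fullv => // V; split=> [SV|fV x y _ _]; last first.
  by apply: (subvP fV); exact: memvf.
rewrite -[X in (X <= _)%VS]/(fullv); apply/contraT => fV.
have dV : (\dim V < n)%N.
  rewrite ltn_neqAle -[X in (_ <= X)%N]dimn dimvS ?subvf // andbT.
  apply: contra fV => /eqP dV; suff -> : V = fullv by [].
  by apply/eqP; rewrite eqEdim subvf dV dimn leqnn.
pose M : 'M[R]_(\dim V, n) := \matrix_i (vbasis V)`_i.
have /rowV0Pn[z zM z0] : kermx M^T != 0.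
  rewrite kermx_eq0 /row_free neq_ltn.
  by rewrite (leq_ltn_trans (rank_leq_col _) dV).
suff : z = 0 by move/eqP; rewrite (negbTE z0).
apply: S1 => x y Sx Sy; have /coord_vbasis -> := SV _ _ Sx Sy.
rewrite dot_sumr big1 // => i _; rewrite dotZr.
suff -> : dot z (vbasis V)`_i = 0 by rewrite mulr0.
have /sub_kermxP/matrixP/(_ 0 i) := zM; rewrite !mxE => <-.
by apply: eq_bigr => k _; rewrite !mxE.
Qed.

Lemma has_dim_singleton (x : 'rV[R]_n) : has_dim [set x] 0.
Proof.
split; first by exists x.
exists 0%VS; first by rewrite dimv0.
by move=> V; split=> [_|_ _ _ -> ->]; rewrite ?sub0v // subrr mem0v.
Qed.

Lemma face_refl S : face S S.
Proof.
exists 0, 0; split=> [x _|]; first by rewrite dot0l.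
by apply/seteqP; split=> x //= => [Sx|[]//]; rewrite dot0l.
Qed.

Lemma face_set0 S : face set0 S.
Proof.
exists 0, 1; split=> [x _|]; first by rewrite dot0l.
apply/seteqP; split=> x //= -[_]; rewrite dot0l => /esym/eqP.
by rewrite oner_eq0.
Qed.

End ConvexSets.

(** * A polyhedron without rays is spanned by its vertices *)

Section Polytope.
Variables (R : realType) (n : nat) (J : finType).
Variables (a : J -> 'rV[R]_n) (b : J -> R).
Let P : set 'rV[R]_n := [set x | forall j, dot (a j) x <= b j].
Let tight x j := dot (a j) x == b j.

Hypothesis no_ray : forall z, z != 0 -> forall x, P x ->
  exists2 t : R, 0 <= t & ~ P (x + t *: z).

(** The ratio test of the simplex method: along [z] tight constraints stay tight, and the first
    slack one that is reached becomes tight. [no_ray] ensures that some constraint is reached. *)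
Lemma move_to_tight x z : P x -> z != 0 ->
  (forall j, tight x j -> dot (a j) z = 0) ->
  exists t, [/\ 0 < t, P (x + t *: z), (forall j, tight x j -> tight (x + t *: z) j)
    & exists2 j, ~~ tight x j & tight (x + t *: z) j].
Proof.
move=> Px z0 xz.
have dE t j : dot (a j) (x + t *: z) = dot (a j) x + t * dot (a j) z.
  by rewrite dotDr dotZr.
have [j0 j0z] : exists j, 0 < dot (a j) z.
  apply/not_existsP => nz; have [t t0 []] := no_ray z0 Px.
  move=> j; rewrite dE; have := Px j; have /negP := nz j; rewrite -leNgt; nra.
pose r j := (b j - dot (a j) x) / dot (a j) z.
case: (@arg_minP _ _ _ j0 (fun j => 0 < dot (a j) z) r j0z) => j jz rj.
have jt : ~~ tight x j by apply: contraTN jz => /xz ->; rewrite ltxx.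
have jx : dot (a j) x < b j by rewrite lt_neqAle jt /= Px.
exists (r j); split.
- by rewrite divr_gt0 // subr_gt0.
- move=> i; rewrite dE; have [iz|iz] := ltP 0 (dot (a i) z).
    by rewrite -lerBrDl -ler_pdivlMr // rj.
  have := Px i; have : 0 <= r j by rewrite divr_ge0 ?subr_ge0 ?ltW.
  nra.
- by move=> i xi; rewrite /tight dE xz // mulr0 addr0.
- have jn : dot (a j) z != 0 by rewrite gt_eqF.
  by exists j => //; rewrite /tight dE /r divfK // addrC subrK.
Qed.

(** Minkowski's theorem, by induction on the number of slack constraints: a point whose tight
    constraints leave a free direction [z] lies between two points, reached along [z] and [- z],
    with fewer slack constraints. *)
Lemma polytope_vertices C : @convex_set R 'rV[R]_n C ->
  (forall x, P x ->
     (forall z, (forall j, tight x j -> dot (a j) z = 0) -> z = 0) -> C x) ->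
  P `<=` C.
Proof.
move=> /convex_setE cC VC x.
have [N] := ubnP #|[pred j | ~~ tight x j]|.
elim: N x => // N IH x; rewrite ltnS => xN Px.
have [Vx|/existsNP[z /not_implyP[xz /eqP z0]]] := pselect
  (forall z, (forall j, tight x j -> dot (a j) z = 0) -> z = 0).
  exact: VC.
have step y : P y -> (forall j, tight x j -> tight y j) ->
    (exists2 j, ~~ tight x j & tight y j) -> C y.
  move=> Py xy [j xj yj]; apply: IH => //; apply: leq_trans xN.
  apply: proper_card; apply/properP; split.
    by apply/fintype.subsetP => i; rewrite !inE; apply: contra; exact: xy.
  by exists j; rewrite !inE // yj.
have [t [t0 Pt xt jt]] := move_to_tight Px z0 xz.
have [s [s0 Ps xs js]] : exists s, [/\ 0 < s, P (x + s *: - z),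
    (forall j, tight x j -> tight (x + s *: - z) j)
    & exists2 j, ~~ tight x j & tight (x + s *: - z) j].
  apply: move_to_tight; rewrite ?oppr_eq0 // => j /xz.
  by rewrite dotNr => ->; rewrite oppr0.
have ts : 0 < s + t by rewrite addr_gt0.
have := cC _ _ (s / (s + t)) _ (step _ Pt xt jt) (step _ Ps xs js).
have -> : s / (s + t) *: (x + t *: z) + (1 - s / (s + t)) *: (x + s *: - z) = x.
  have -> : 1 - s / (s + t) = t / (s + t) by field; rewrite gt_eqF.
  rewrite !scalerDr !scalerA addrACA -scalerDl scalerN -mulrDl divff ?gt_eqF //.
  by rewrite scale1r mulrAC [t / _ * _]mulrAC [t * s]mulrC subrr addr0.
apply; rewrite divr_ge0 ?(ltW s0) ?(ltW ts) //= ler_pdivrMr // mul1r.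
by rewrite lerDl ltW.
Qed.

End Polytope.

(** * Regular subdivisions *)

Lemma sum_option (V : nmodType) (I : finType) (F : option I -> V) :
  \sum_o F o = F None + \sum_i F (Some i).
Proof.
rewrite (bigD1 None) //=; congr (_ + _).
rewrite (reindex_omap Some id) /=; last by case.
by apply: eq_bigl => i; rewrite eqxx.
Qed.

Section RegularSubdivision.
Variables (R : realType) (n : nat) (I : finType) (i0 : I).
Variables (q : I -> 'rV[R]_n) (c : I -> R).
Implicit Types (x y z : 'rV[R]_n) (i j : I).

Definition aff i x : R := dot x (q i) + c i.

(** A real-valued counterpart of [max_affine]; [i0] witnesses that there is an index, and the arg
    max supplies an active one. *)
Definition pmax x : R := aff [arg max_(i > i0) aff i x]%O x.

Definition active x : pred I := fun i => aff i x == pmax x.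

Lemma aff_le_pmax i x : aff i x <= pmax x.
Proof. by rewrite /pmax; case: arg_maxP => // j _; apply. Qed.

Lemma pmax_le x (b : R) : (forall i, aff i x <= b) -> pmax x <= b.
Proof. by move=> xb; exact: xb. Qed.

Lemma active_exists x : exists i, active x i.
Proof. by exists [arg max_(i > i0) aff i x]%O; exact: eqxx. Qed.

Lemma active_pmax x i : active x i -> pmax x = aff i x.
Proof. by move/eqP. Qed.

Lemma activeP x i : reflect (forall j, aff j x <= aff i x) (active x i).
Proof.
apply: (iffP eqP) => [-> j|xi]; first exact: aff_le_pmax.
by apply/eqP; rewrite eq_le aff_le_pmax pmax_le.
Qed.

Lemma affB i x z : aff i (x + z) = aff i x + dot z (q i).
Proof. by rewrite /aff dotDl addrAC. Qed.

Lemma pmax_midpoint x z : pmax (2^-1 *: (x + z)) <= (pmax x + pmax z) / 2.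
Proof.
apply: pmax_le => i; rewrite /aff dotZl dotDl.
have := aff_le_pmax i x; have := aff_le_pmax i z; rewrite /aff; lra.
Qed.

Definition support := hull q xpredT.

Definition sigma x := hull q (active x).

Lemma sigma_support x : sigma x `<=` support.
Proof. exact: hull_sub. Qed.

Lemma sigma_neq0 x : sigma x !=set0.
Proof. by have [i xi] := active_exists x; exists (q i); exact: hull_pt. Qed.

(* Weyl's theorem for the epigraph of the convex hull of the points
   (q i, - c i), whose lower facets are supported by affine forms of slope x. *)
Lemma sigma_cover y : support y -> exists x, sigma x y.
Proof.
move=> [k [k0 _ k1 ky]].
(* The generator [None] points straight up; together with the lifted points it spans the cone over
   the epigraph. *)
pose u (o : option I) : 'rV[R]_(n + 1 + 1) :=
  if o is Some i then homog (homog (q i) (- c i)) 1 else homog (homog 0 1) 0.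
have [A uA] := weyl u.
pose epi s := exists2 l : I -> R, forall i, 0 <= l i &
  [/\ \sum_i l i = 1, \sum_i l i *: q i = y & - \sum_i l i * c i <= s].
have sumu (l : option I -> R) : \sum_o l o *: u o =
    homog (homog (\sum_i l (Some i) *: q i)
                 (l None - \sum_i l (Some i) * c i)) (\sum_i l (Some i)).
  rewrite sum_option /= addrC.
  rewrite (eq_bigr (fun i => l (Some i) *: homog (homog (q i) (- c i)) 1)) //.
  rewrite !sum_homog !homogZ !homogD scaler0 addr0 mulr0 addr0 mulr1.
  congr (homog (homog _ _) _); last by apply: eq_bigr => i _; rewrite mulr1.
  rewrite addrC; congr (_ + _); rewrite -sumrN.
  by apply: eq_bigr => i _; rewrite mulrN.
have epiA s : epi s <-> forall a, a \in A -> dot a (homog (homog y s) 1) <= 0.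
  rewrite -uA; split=> [[l l0 [l1 ly ls]]|[l l0]].
    exists (fun o => if o is Some i then l i else s + \sum_i l i * c i) => [[i|]//|].
      by rewrite -[X in _ + X]opprK subr_ge0.
    by rewrite sumu l1 ly addrK.
  rewrite sumu => /homog_inj[/homog_inj[ly ls] l1].
  by exists (fun i => l (Some i)) => //; split => //; rewrite ls lerBrDr addNr.
have uA0 a o : a \in A -> dot a (u o) <= 0.
  move=> aA; apply: (uA _).1 aA; exists (fun p => (p == o)%:R) => [p|].
    by rewrite ler0n.
  rewrite (bigD1 o) //= eqxx scale1r big1 ?addr0 // => p /negbTE ->.
  by rewrite scale0r.
pose slope (a : 'rV[R]_(n + 1 + 1)) : 'rV[R]_n := lsubmx (lsubmx a).
pose b (a : 'rV[R]_(n + 1 + 1)) := - rsubmx (lsubmx a) 0 0.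
pose e (a : 'rV[R]_(n + 1 + 1)) := rsubmx a 0 0.
have dotA a z s t :
    dot a (homog (homog z s) t) = dot (slope a) z - b a * s + e a * t.
  rewrite /slope /b /e; have [a' [t' ->]] := homogP a.
  have [z' [s' ->]] := homogP a'.
  by rewrite !dot_homog !row_mxKl !row_mxKr !mxE !mulr1n mulNr opprK.
have b0 a : a \in A -> 0 <= b a.
  by move=> /(uA0 _ None); rewrite /= dotA dot0r mulr1 mulr0 addr0 add0r oppr_le0.
have qA a i : a \in A -> dot (slope a) (q i) + b a * c i + e a <= 0.
  by move=> /(uA0 _ (Some i)); rewrite /= dotA mulrN opprK mulr1.
have eA s : epi s <-> forall a, a \in A -> dot (slope a) y + e a <= b a * s.
  rewrite epiA; split=> sA a aA; have := sA a aA; rewrite dotA; lra.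
pose s0 := - \sum_i k i * c i.
have epi0 : epi s0 by exists k.
(* A lower bound for the heights over [y]; it rules out that all inequalities of [A] are
   vertical. *)
pose m : R := - \sum_i `|c i|.
have epi_ge s : epi s -> m <= s.
  move=> [l l0 [l1 _ ls]]; apply: le_trans ls; rewrite lerN2.
  apply: ler_sum => i _; apply: (le_trans (ler_norm _)); rewrite normrM ger0_norm //.
  by rewrite ler_piMl // -l1 (bigD1 i) //= lerDl sumr_ge0.
pose B := [seq a <- A | 0 < b a].
pose val a := (dot (slope a) y + e a) / b a.
(* Inequalities with [b a = 0] do not involve the height; they hold at [y] because [epi] is
   inhabited. *)
have epiB s : (forall a, a \in B -> val a <= s) -> epi s.
  move=> sB; apply/eA => a aA; have := b0 a aA; rewrite le_eqVlt => /orP[/eqP ba|ba].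
    have /eA/(_ a aA) := epi0; by rewrite -ba !mul0r.
  by rewrite mulrC -ler_pdivrMr // sB // mem_filter ba.
have [a aB aM] : exists2 a, a \in B & forall a', a' \in B -> val a' <= val a.
  case EB : B => [|a1 B'].
    have : epi (m - 1) by apply: epiB; rewrite EB.
    by move=> /epi_ge; rewrite lerBrDr gerDl ler10.
  elim: B' a1 {EB} => [|a2 B' IH] a1.
    by exists a1; rewrite ?inE // => a'; rewrite inE => /eqP ->.
  have [a aB aM] := IH a2; have [a1a|aa1] := leP (val a1) (val a).
    exists a; first by rewrite inE aB orbT.
    by move=> a'; rewrite inE => /orP[/eqP ->//|]; exact: aM.
  exists a1; rewrite ?inE ?eqxx // => a'; rewrite inE => /orP[/eqP ->//|a'B].
  exact: le_trans (aM _ a'B) (ltW aa1).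
have [ba aA] : 0 < b a /\ a \in A by move: aB; rewrite mem_filter => /andP[].
(* The largest of the lower bounds is itself a height of the epigraph, and the inequality [a] is
   tight there. *)
have [l l0 [l1 ly ls]] := epiB _ aM.
pose x := (b a)^-1 *: slope a; pose D := - e a / b a.
have xD i : aff i x <= D.
  rewrite /aff /D /x dotZl mulrC ler_pdivlMr // mulrDl divfK ?gt_eqF //.
  have := qA a i aA; lra.
have val_a : val a = dot x y - D by rewrite /val /x /D dotZl; field; rewrite gt_eqF.
(* Complementary slackness: nonnegative terms with a nonpositive sum vanish, so only points that
   reach [D] carry weight. *)
have l_active i : l i * (D - aff i x) = 0.
  have S0 : \sum_i l i * (D - aff i x) <= 0.
    have -> : \sum_i l i * (D - aff i x) =
        D * (\sum_i l i) - dot x (\sum_i l i *: q i) - \sum_i l i * c i.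
      rewrite dot_sumr mulr_sumr -!sumrB; apply: eq_bigr => j _.
      by rewrite dotZr /aff; ring.
    rewrite l1 ly; move: ls; rewrite val_a; lra.
  have P0 j : true -> 0 <= l j * (D - aff j x) by rewrite mulr_ge0 ?subr_ge0.
  by apply: (psumr_eq0P P0) => //; apply/eqP; rewrite eq_le S0 sumr_ge0.
exists x, l; split=> // i; apply: contraNeq => li; apply/activeP => j.
have /eqP := l_active i; rewrite mulf_eq0 (negbTE li) subr_eq0 => /eqP <-.
exact: xD.
Qed.

(** The bound by [pmax] is an equality for [x] at each point that carries weight, and an inequality
    for [x']; average over these points. *)
Lemma sigma_le x x' y : sigma x y -> dot x' y - pmax x' <= dot x y - pmax x.
Proof.
move=> [l [l0 lx l1 <-]]; rewrite -[pmax x]mulr1 -[pmax x']mulr1 -l1.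
rewrite !dot_sumr !mulr_sumr -!sumrB; apply: ler_sum => i _.
rewrite !dotZr; have [xi|/lx ->] := boolP (active x i); last by lra.
have := active_pmax xi; have := aff_le_pmax i x'; have := l0 i; rewrite /aff; nra.
Qed.

(** On [support] the Legendre dual is finite and [fine] keeps it; elsewhere +oo becomes 0. *)
Definition dual y : R := fine (legendre (fun x => (pmax x)%:E) y).

Lemma legendre_sigma x y : sigma x y ->
  legendre (fun x => (pmax x)%:E) y = (dot x y - pmax x)%:E.
Proof.
move=> xy; apply/eqP; rewrite eq_le; apply/andP; split.
  by apply: ge_ereal_sup => _ [x' _ <-]; rewrite -EFinB lee_fin sigma_le.
by apply: ereal_sup_ubound; exists x; rewrite ?EFinB.
Qed.

Lemma dual_sigma x y : sigma x y -> dual y = dot x y - pmax x.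
Proof. by move=> xy; rewrite /dual (legendre_sigma xy). Qed.

Lemma dual_ge x y : support y -> dot x y - pmax x <= dual y.
Proof. by move=> /sigma_cover[z zy]; rewrite (dual_sigma zy) sigma_le. Qed.

(** The equality case of Fenchel's inequality, which turns questions about cells into arithmetic.
    Equality forces the weights of [y] onto the points active at [x], again by complementary
    slackness. *)
Lemma sigmaP x y : support y -> sigma x y <-> dual y = dot x y - pmax x.
Proof.
move=> /sigma_cover[z zy]; split; first exact: dual_sigma.
rewrite (dual_sigma zy); have [l [l0 lz l1 ly]] := zy => zx.
exists l; split=> // i; apply: contraNeq => li.
have S0 : \sum_j l j * (pmax x - aff j x) = 0.
  transitivity (pmax x - dot x y - \sum_j l j * c j).
    rewrite -ly dot_sumr -[pmax x in RHS]mulr1 -l1 mulr_sumr -!sumrB.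
    by apply: eq_bigr => j _; rewrite dotZr /aff; ring.
  suff <- : pmax z - dot z y = \sum_j l j * c j by lra.
  rewrite -ly dot_sumr -[pmax z]mulr1 -l1 mulr_sumr -!sumrB.
  apply: eq_bigr => j _; rewrite dotZr.
  have [zj|/lz ->] := boolP (active z j); last by lra.
  by rewrite (active_pmax zj) /aff; ring.
have P0 j : true -> 0 <= l j * (pmax x - aff j x).
  by rewrite mulr_ge0 ?subr_ge0 ?aff_le_pmax.
have /eqP := psumr_eq0P P0 S0 (i := i) isT; rewrite mulf_eq0 (negbTE li) subr_eq0.
by rewrite eq_sym.
Qed.

(** If [a] separates [y] from [support], the terms of the supremum at [s *: a] grow without bound
    with [s]; [C] bounds all the [c i]. *)
Lemma legendre_domain_support :
  legendre_domain (fun x => (pmax x)%:E) = support.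
Proof.
apply/seteqP; split=> y /=; last first.
  by move=> /sigma_cover[x xy]; rewrite /legendre_domain /= (legendre_sigma xy) ltry.
apply: contraPP => /hull_separation[a [b [qb ab]]].
pose C := \sum_i `|c i|.
have Cc i : c i <= C.
  by apply: le_trans (ler_norm _) _; rewrite /C (bigD1 i) //= lerDl sumr_ge0.
have big_dual s : 0 <= s ->
    ((s * (dot a y - b) - C)%:E <= legendre (fun x => (pmax x)%:E) y)%E.
  move=> s0; apply: (@le_trans _ _ (dot (s *: a) y - pmax (s *: a))%:E).
    rewrite lee_fin dotZl.
    suff : pmax (s *: a) <= s * b + C by lra.
    by apply: pmax_le => i; rewrite /aff dotZl lerD // ler_wpM2l // qb.
  by apply: ereal_sup_ubound; exists (s *: a); rewrite ?EFinB.
apply/negP; rewrite -leNgt leye_eq; apply/eqP/eqyP => A A0.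
have {}ab : 0 < dot a y - b by rewrite subr_gt0.
have C0 : 0 <= C by apply: sumr_ge0.
apply: le_trans (big_dual ((A + C) / (dot a y - b)) _).
  by rewrite lee_fin divfK ?gt_eqF // addrK.
by rewrite divr_ge0 ?(ltW ab) // addr_ge0 // ltW.
Qed.

(** The slope of a cell through the combination gives an affine minorant of [dual] that is exact
    there. *)
Lemma dual_convex x y (t : R) : 0 <= t <= 1 -> support x -> support y ->
  dual (t *: x + (1 - t) *: y) <= t * dual x + (1 - t) * dual y.
Proof.
move=> t01 sx sy; have [z zxy] := sigma_cover (hull_conv t01 sx sy).
rewrite (dual_sigma zxy) dotDr !dotZr; move: t01 => /andP[t0 t1].
have := dual_ge z sx; have := dual_ge z sy; nra.
Qed.

Definition cells : set (set 'rV[R]_n) :=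
  [set s | s = set0 \/ exists x, s = sigma x].

(** A cell depends on its slope only through the set of active indices. *)
Lemma finite_cells : finite_set cells.
Proof.
pose S := set0 |` [set hull q [eta mem A] | A in [set: {set I}]].
apply: (@sub_finite_set _ _ S) => [_ [->|[x ->]]|]; first by left.
  right; exists [set i | active x i]%SET => //.
  by apply/seteqP; split; apply: hull_sub => i /=; rewrite inE.
by rewrite finite_setU; split; [exact: finite_set1|exact: finite_image].
Qed.

Lemma set0_polyhedron : convex_polyhedron (set0 : set 'rV[R]_n).
Proof.
exists 1%N, (fun=> 0), (fun=> -1); apply/seteqP; split=> x //= /(_ ord0).
by rewrite dot0l lerNr oppr0 ler10.
Qed.

(** Fenchel's inequality at a common point forces [pmax] at the midpoint to be the mean of its two
    values. For any [y] the inequality of the midpoint slope is then the mean of the other two, and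
    is an equality only if both are. *)
Lemma sigmaI x x' : sigma x `&` sigma x' !=set0 ->
  sigma x `&` sigma x' = sigma (2^-1 *: (x + x')).
Proof.
move=> [z [xz x'z]]; pose x'' := 2^-1 *: (x + x').
have mid y : dot x'' y = (dot x y + dot x' y) / 2 by rewrite dotZl dotDl mulrC.
have sz := sigma_support xz.
have := dual_sigma xz; have := dual_sigma x'z; have := dual_ge x'' sz.
have := pmax_midpoint x x'; rewrite -/x'' mid => h1 h2 h3 h4.
have pE : pmax x'' = (pmax x + pmax x') / 2 by lra.
apply/seteqP; split=> y => [[xy x'y]|x''y].
  have sy := sigma_support xy; apply/sigmaP => //; rewrite mid pE.
  by rewrite -/x''; have := dual_sigma xy; have := dual_sigma x'y; lra.
have sy := sigma_support x''y; have := dual_sigma x''y; rewrite -/x'' mid pE.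
have := dual_ge x sy; have := dual_ge x' sy => k1 k2 k3.
by split; apply/sigmaP => //; lra.
Qed.

(** On [sigma x] the bound on the form [x' - x] is Fenchel's inequality for [x'], attained exactly
    on [sigma x']. *)
Lemma sigma_face x x' : sigma x' `<=` sigma x -> face (sigma x') (sigma x).
Proof.
move=> x'x; exists (x' - x), (pmax x' - pmax x).
have E y : sigma x y -> dual y = dot x y - pmax x by exact: dual_sigma.
split=> [y xy|].
  by rewrite dotBl; have := E _ xy; have := dual_ge x' (sigma_support xy); lra.
apply/seteqP; split=> y => [x'y|[xy /= xx']].
  split; first exact: x'x.
  rewrite /= dotBl; have := E _ (x'x _ x'y); have := dual_sigma x'y; lra.
apply/sigmaP; first exact: sigma_support xy.
by move: xx'; rewrite dotBl (E _ xy); lra.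
Qed.

(** After a small tilt of [x] in the direction [a] that exposes the face, only those points active
    at [x] that maximize [a] can remain active. *)
Lemma face_sigma x F : face F (sigma x) -> cells F.
Proof.
move=> [a [b [ab FE]]]; have [F0|/set0P[y Fy]] := eqVneq F set0; first by left.
right; have aq i : active x i -> dot a (q i) <= b by move=> xi; apply/ab/hull_pt.
have [i xi ai] : exists2 i, active x i & dot a (q i) = b.
  apply/exists2P/not_existsP => ni.
  move: Fy; rewrite FE => -[[l [l0 lx l1 ly]] /= yb].
  have S0 : \sum_i l i * (b - dot a (q i)) = 0.
    rewrite (_ : \sum_i _ = b * (\sum_i l i) - dot a (\sum_i l i *: q i)).
      by rewrite l1 ly yb mulr1 subrr.
    rewrite dot_sumr mulr_sumr -sumrB; apply: eq_bigr => i _.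
    by rewrite dotZr; ring.
  have P0 i : true -> 0 <= l i * (b - dot a (q i)).
    have [xi|/lx ->] := boolP (active x i); last by rewrite mul0r.
    by rewrite mulr_ge0 ?subr_ge0 // aq.
  suff : \sum_i l i = 0 by rewrite l1 => /eqP; rewrite oner_eq0.
  apply: big1 => i _; have [xi|/lx//] := boolP (active x i).
  have /eqP := psumr_eq0P P0 S0 (i := i) isT.
  by rewrite mulf_eq0 subr_eq0 => /orP[/eqP//|/eqP bi]; case: (ni i).
(* [r j] is a tilt that keeps the inactive index [j] inactive; adding 1 keeps the divisor positive.
   The minimum starts at 1 for the case that all indices are active. *)
pose r j := (pmax x - aff j x) / (`|dot a (q j) - b| + 1).
pose e := \big[Num.min/1]_(j | ~~ active x j) r j.
have e0 : 0 < e.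
  apply: lt_bigmin => // j xj; apply: divr_gt0; last by rewrite ltr_wpDl.
  by rewrite subr_gt0 lt_neqAle aff_le_pmax andbT.
have lt_e j : ~~ active x j -> aff j x + e * (dot a (q j) - b) < pmax x.
  move=> xj; have := @bigmin_le_cond _ _ _ 1 j (predC (active x)) r xj; rewrite -/e /r.
  set d := dot a (q j) - b; have d0 : 0 < `|d| + 1 by rewrite ltr_wpDl.
  rewrite (ler_pdivlMr _ _ d0).
  have : e * d <= e * `|d| by rewrite ler_wpM2l ?ler_norm // ltW.
  by move: e0; lra.
have pE : pmax (x + e *: a) = pmax x + e * b.
  apply/eqP; rewrite eq_le; apply/andP; split.
    apply: pmax_le => j; rewrite affB dotZl.
    have [xj|/lt_e] := boolP (active x j); last by lra.
    by rewrite -(active_pmax xj) lerD2l ler_pM2l // aq.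
  by have := aff_le_pmax i (x + e *: a); rewrite affB dotZl ai (active_pmax xi).
exists (x + e *: a); rewrite FE; apply/seteqP; split=> z => [[xz /= az]|].
  apply/sigmaP; first exact: sigma_support xz.
  by rewrite dotDl dotZl az pE (dual_sigma xz); ring.
have xa j : active (x + e *: a) j -> active x j /\ dot a (q j) = b.
  rewrite {1}/active affB dotZl pE => /eqP aj.
  have xj : active x j by apply/contraT => /lt_e; lra.
  split=> //; move: aj; rewrite (active_pmax xj) => /addrI/mulfI; apply.
  by rewrite gt_eqF.
move=> zs; have zx : sigma x z by apply: hull_sub zs => j /xa[].
split=> //=; apply/eqP; rewrite eq_le ab //= -lerN2 -dotNl.
by apply: hull_dot_le zs => j /xa[_]; rewrite dotNl => ->.
Qed.

Lemma cells_decomposition : convex_cell_decomposition support cells.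
Proof.
split.
- split; first exact: finite_cells.
  by move=> s [->|[x ->]]; [exact: set0_polyhedron|exact: hull_polyhedron].
- apply/seteqP; split=> [y /sigma_cover[x xy]|y [s [->|[x ->]]]] //.
    by exists (sigma x) => //; right; exists x.
  exact: sigma_support.
- move=> s t [->|[x ->]]; first by rewrite set0I; left.
  move=> [->|[x' ->]]; first by rewrite setI0; left.
  have [->|/set0P xx'] := eqVneq (sigma x `&` sigma x') set0; first by left.
  by right; eexists; exact: sigmaI.
- move=> s t [->|[x ->]].
    by rewrite subset0 => ->; split=> _; [exact: face_refl|left].
  move=> ts; split=> [[->|[x' tE]]|]; first exact: face_set0.
    by rewrite tE; apply: sigma_face; rewrite -tE.
  exact: face_sigma.
Qed.

Lemma cells_piecewise_linear : piecewise_linear cells dual.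
Proof.
move=> s [->|[x ->]]; first by exists 0, 0.
by exists x, (- pmax x) => y; exact: dual_sigma.
Qed.

(** The open counterpart of [active]: it makes [q i] a cell by itself, and for a [p j] it detects
    positive cell volume. *)
Definition dominant i x := forall j, j != i -> aff j x < aff i x.

Lemma dominant_active i x : dominant i x -> active x i.
Proof. by move=> xi; apply/activeP => j; have [->//|/xi/ltW] := eqVneq j i. Qed.

Lemma dominant_sigma i x : dominant i x -> sigma x = [set q i].
Proof.
move=> xi; have ai := dominant_active xi; apply/seteqP; split=> y.
  move=> [l [l0 lx l1 <-]] /=.
  have li j : j != i -> l j = 0.
    move=> /xi ji; apply: lx; apply: contraTN ji => /activeP/(_ i).
    by rewrite -leNgt.
  rewrite (bigD1 i) //= big1 => [|j /li ->]; last by rewrite scale0r.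
  move: l1; rewrite (bigD1 i) //= big1 // => /[!addr0] ->.
  by rewrite scale1r.
by move=> ->; exact: hull_pt.
Qed.

Lemma dominant_vertex i x : dominant i x -> is_vertex cells (q i).
Proof.
move=> xi; exists (sigma x); split.
- by right; exists x.
- by rewrite (dominant_sigma xi); exact: has_dim_singleton.
- by rewrite (dominant_sigma xi).
Qed.

Lemma dominant_exists i (a : 'rV[R]_n) :
  (forall j, j != i -> dot a (q j) < dot a (q i)) -> exists x, dominant i x.
Proof.
(* From the scale [s j] on, the gain in direction [a] outweighs the difference of the constants; the
   1 makes this strict. *)
move=> ai; pose s j := (`|c j - c i| + 1) / (dot a (q i) - dot a (q j)).
have s0 j : j != i -> 0 <= s j.
  by move=> /ai ji; rewrite divr_ge0 ?subr_ge0 ?(ltW ji) // addr_ge0.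
pose t := \sum_(j | j != i) s j; exists (t *: a) => j ji.
have : s j <= t.
  by rewrite /t (bigD1 j) //= lerDl sumr_ge0 // => l /andP[/s0].
rewrite ler_pdivrMr ?subr_gt0 ?ai // /aff !dotZl.
by have := ler_norm (c j - c i); lra.
Qed.

Lemma active_dual i x : active x i -> dual (q i) = - c i.
Proof.
move=> xi; rewrite (@dual_sigma x); last exact: hull_pt.
by rewrite (active_pmax xi) /aff opprD addNKr.
Qed.

Lemma sigma_active i x x0 : active x0 i -> sigma x (q i) -> active x i.
Proof.
move=> /active_dual iE /dual_sigma; rewrite iE /active /aff => h; apply/eqP; lra.
Qed.

(** The slope on a full-dimensional cell is unique, so gradients lie where [i] is active. That set
    is a polyhedron, without rays by the second hypothesis. At a vertex the normals of the tight
    constraints span, which says that the cell of this slope is full-dimensional; hence every vertex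
    is a gradient. *)
Lemma hull_gradients i : (exists x, active x i) ->
  (forall z, z != 0 -> forall x, active x i ->
     exists2 t : R, 0 <= t & ~~ active (x + t *: z) i) ->
  convex_hull (gradients_at cells dual (q i)) = [set x | active x i].
Proof.
move=> [x0 x0i] no_ray.
pose P := [set x : 'rV[R]_n | forall j, dot (q j - q i) x <= c i - c j].
have PE x : P x <-> active x i.
  have jE j : (dot (q j - q i) x <= c i - c j) = (aff j x <= aff i x).
    by rewrite /aff dotBl !(dotC _ x); apply/idP/idP; lra.
  split=> [xP|/activeP xi j]; last by rewrite jE.
  by apply/activeP => j; rewrite -jE; exact: xP.
have cP : @convex_set R 'rV[R]_n [set x | active x i].
  apply/convex_setE => x y t /andP[t0 t1] /PE xi /PE yi; apply/PE => j.
  by rewrite dotDr !dotZr; have := xi j; have := yi j; nra.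
apply/seteqP; split.
  apply: convex_hull_min => // a [s [b [sT /has_dim_full[s0 sn] si sa]]].
  case: sT => [sE|[x sE]]; first by rewrite sE in si.
  rewrite sE in s0 sn si sa; suff -> : a = x by exact: (sigma_active x0i si).
  apply/eqP; rewrite -subr_eq0; apply/eqP/sn => y y' xy xy'.
  rewrite dotBr !dotBl; have := sa _ xy; have := sa _ xy'.
  by rewrite (dual_sigma xy) (dual_sigma xy'); lra.
move=> x /PE; apply: (@polytope_vertices _ _ I (fun j => q j - q i)
    (fun j => c i - c j)) x.
- move=> z z0 x /PE /(no_ray _ z0)[t t0 xt]; exists t => // /PE.
  by move: xt; exact: negP.
- exact: convex_hull_convex.
move=> x /PE xi xz; apply: sub_convex_hull.
exists (sigma x), (- pmax x); split; first by right; exists x.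
- apply/has_dim_full; split=> [|z zx]; first exact: sigma_neq0.
  apply: xz => j xj; have jx : active x j.
    rewrite /active (active_pmax xi) /aff; move: xj.
    by rewrite dotBl !(dotC _ x) => /eqP h; apply/eqP; lra.
  by rewrite dotC; apply: zx; exact: hull_pt.
- exact: hull_pt.
- by move=> y; exact: dual_sigma.
Qed.

End RegularSubdivision.

(** * Volume and integration *)

Section Volume.
Variable R : realType.
Local Notation mu := (@lebesgue_measure R).

Lemma volume_ge0 n (S : set 'rV[R]_n) : (0 <= volume S)%E.
Proof.
case: n S => [|n] S /=; first by rewrite lee_fin indicE ler0n.
by apply: integral_ge0 => x _; elim: n {S} [set y | _] => [|n IH] S /=;
  [rewrite lee_fin indicE ler0n|apply: integral_ge0 => y _; exact: IH].
Qed.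

Lemma volume_set0 n : volume (set0 : set 'rV[R]_n) = 0%E.
Proof.
elim: n => [|n IH] /=; first by rewrite indicE in_set0.
by apply: integral0_eq => x _; exact: IH.
Qed.

Lemma row_mx_head n (x : R) (y : 'rV[R]_n) :
  (row_mx (x%:M : 'M[R]_1) y : 'rV[R]_n.+1) 0 0 = x.
Proof.
have -> : 0 = lshift n (0 : 'I_1) :> 'I_n.+1 by exact/val_inj.
by rewrite [LHS](@row_mxEl _ 1 1 n x%:M y 0 0) mxE.
Qed.

Lemma volume_cylinder n (A : set (measurableTypeR R)) (B : set 'rV[R]_n) : measurable A ->
  volume [set z : 'rV[R]_n.+1 | A (z 0 0) /\ B (@rsubmx _ 1 1 n z)] =
  (mu A * volume B)%E.
Proof.
move=> mA /=.
rewrite (eq_integral (fun x : measurableTypeR R => (\1_A x)%:E * volume B)%E); last first.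
  move=> x _; rewrite indicE; have [xA|xA] := boolP (x \in A).
    rewrite mul1e; congr volume.
    apply/seteqP; split=> y /=; rewrite row_mxKr row_mx_head; first by case.
    by move=> By; split=> //; exact/set_mem.
  rewrite mul0e (_ : [set _ | _] = set0) ?volume_set0 //.
  by apply/seteqP; split=> y //= -[]; rewrite row_mx_head => /mem_set; rewrite (negbTE xA).
rewrite ge0_integralZr ?integral_indic ?setIT //.
- exact/measurable_EFinP/measurable_indic.
- exact: volume_ge0.
Qed.

Definition cube n (x0 : 'rV[R]_n) (r : R) : set 'rV[R]_n :=
  [set x | forall i, `|x 0 i - x0 0 i| <= r].

Lemma volume_cube n (x0 : 'rV[R]_n) (r : R) : 0 <= r ->
  volume (cube x0 r) = ((2 * r) ^+ n)%:E.
Proof.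
move=> r0; elim: n x0 => [|n IH] x0.
  by rewrite /= indicE mem_set // => -[].
rewrite (_ : cube x0 r = [set z : 'rV[R]_n.+1 | [set` `[x0 0 0 - r, x0 0 0 + r]] (z 0 0) /\
    cube (@rsubmx _ 1 1 n x0) r (@rsubmx _ 1 1 n z)]).
  rewrite volume_cylinder // IH lebesgue_measure_itv /= lte_fin.
  rewrite exprS EFinM; congr (_ * _)%E.
  have [r00|] := ltP; first by rewrite -EFinB; congr EFin; ring.
  by move=> h; congr EFin; lra.
apply/seteqP; split=> z /=.
  move=> zx; split; first by have := zx 0; rewrite ler_distl in_itv.
  by move=> i; rewrite !mxE; exact: zx.
move=> [z0 zx] i; have [j ij|j ij] := split_ordP (i : 'I_(1 + n)).
  have -> : i = 0 by apply/val_inj; rewrite ij /= ord1.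
  by rewrite ler_distl; move: z0; rewrite /= in_itv.
by have := zx j; rewrite !mxE ij.
Qed.

Lemma dot_head_tail n (a z : 'rV[R]_n.+1) :
  dot a z = a 0 0 * z 0 0 + dot (@rsubmx _ 1 1 n a) (@rsubmx _ 1 1 n z).
Proof.
rewrite /dot big_ord_recl; congr (_ + _); apply: eq_bigr => i _.
by rewrite !mxE; congr (a _ _ * z _ _); exact: val_inj.
Qed.

(** Sections along the first coordinate are hyperplanes one dimension lower, unless only the first
    coordinate of [a] is nonzero; then the set is a cylinder over a point. *)
Lemma volume_hyperplane n (a : 'rV[R]_n) (b : R) : a != 0 ->
  volume [set x | dot a x = b] = 0%E.
Proof.
elim: n a b => [|n IH] a b; first by rewrite thinmx0 eqxx.
have [a'0|a'0 a0] := eqVneq (@rsubmx _ 1 1 n a) 0; last first.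
  apply: integral0_eq => x _ /=.
  rewrite (_ : [set _ | _] = [set y | dot (@rsubmx _ 1 1 n a) y = b - a 0 0 * x]).
    exact: IH.
  by apply/seteqP; split=> y /=; rewrite dot_head_tail row_mx_head row_mxKr => h; lra.
move=> a0; have a00 : a 0 0 != 0.
  apply: contra a0 => /eqP a00; apply/eqP/rowP => i; rewrite mxE.
  have [j ij|j ij] := split_ordP (i : 'I_(1 + n)).
    by have -> : i = 0 by apply/val_inj; rewrite ij /= ord1.
  by have /rowP/(_ j) := a'0; rewrite !mxE ij.
rewrite (_ : [set _ | _] = [set z : 'rV[R]_n.+1 | [set b / a 0 0] (z 0 0) /\
    setT (@rsubmx _ 1 1 n z)]).
  by rewrite volume_cylinder // lebesgue_measure_set1 mul0e.
apply/seteqP; split=> z /=; rewrite dot_head_tail a'0 dot0l addr0.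
  by move=> <-; rewrite mulrC mulKf.
by move=> [-> _]; rewrite mulrC divfK.
Qed.

Section FiniteMeasurable.
Context d (T : measurableType d) (J : finType).

Lemma measurable_forall (A : J -> set T) :
  (forall j, measurable (A j)) -> measurable [set t | forall j, A j t].
Proof.
move=> mA; rewrite (_ : mkset _ = \bigcap_(j in [set: J]) A j).
  by apply: fin_bigcap_measurable => //; exact: finite_finset.
by apply/seteqP; split=> t /= At j; [move=> _|]; exact: At.
Qed.

Lemma measurable_exists (A : J -> set T) :
  (forall j, measurable (A j)) -> measurable [set t | exists j, A j t].
Proof.
move=> mA; rewrite (_ : mkset _ = \bigcup_(j in [set: J]) A j).
  by apply: fin_bigcup_measurable => //; exact: finite_finset.
by apply/seteqP; split=> t /= [j] => [|_] Aj; exists j.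
Qed.

End FiniteMeasurable.

Lemma measurable_cube d (T : measurableType d) n (e : T -> 'rV[R]_n) x0 (r : R) :
  (forall i, measurable_fun setT (fun t => e t 0 i)) ->
  measurable (e @^-1` cube x0 r).
Proof.
move=> em; apply: measurable_forall => i; rewrite -[X in measurable X]setTI.
apply: measurable_fun_le => //.
apply: measurableT_comp; first exact: normr_measurable.
exact: measurable_funB.
Qed.

(* [volume] is only a function on sets; a model realizes it by a measure, on an
   iterated product type, so that integration theory applies. *)
Record volume_model n := VolumeModel {
  vm_display : measure_display;
  vm_type : measurableType vm_display;
  vm_measure : {sigma_finite_measure set vm_type -> \bar R};
  vm_pt : vm_type -> 'rV[R]_n;
  vm_coord : forall i, measurable_fun setT (fun t => vm_pt t 0 i);
  vm_volume : forall S, volume S = vm_measure (vm_pt @^-1` S) }.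

(** Sigma-finiteness has to be bundled with the measure before the next product can be formed over
    it. *)
Lemma sigma_finite_pack d (T : measurableType d) (m : {measure set T -> \bar R}) :
  sigma_finite setT m ->
  exists M : {sigma_finite_measure set T -> \bar R}, M = m :> (set T -> \bar R).
Proof.
move=> mT.
pose sf := isSFinite.Build _ _ _ _ (sfinite_measure_sigma_finite mT).
pose sgf := isSigmaFinite.Build _ _ _ _ mT.
by exists (HB.pack_for (SigmaFiniteMeasure.type T R) (Measure.sort m) sf sgf).
Qed.

Lemma volume_model_exists n : inhabited (volume_model n).
Proof.
elim: n => [|n [[d T m e em eV]]].
  constructor; apply: (@VolumeModel 0 _ unit (\d_tt) (fun=> 0)) => [[]//|S].
  by rewrite /= diracE indicE; congr ((nat_of_bool _)%:R)%:E.
pose e' (z : measurableTypeR R * T) : 'rV[R]_n.+1 := row_mx (z.1%:M : 'M[R]_1) (e z.2).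
pose M0 : {measure set (measurableTypeR R * T)%type -> \bar R} :=
  @product_measure1 _ _ _ _ _ mu m.
have e'm i : measurable_fun setT (fun z => e' z 0 i).
  have [j ij|j ij] := split_ordP (i : 'I_(1 + n)).
    rewrite (_ : (fun _ => _) = fst) //; apply/funext => z.
    by rewrite ij [LHS](@row_mxEl _ 1 1 n) ord1 mxE.
  rewrite (_ : (fun _ => _) = (fun t => e t 0 j) \o snd).
    exact: measurableT_comp.
  by apply/funext => z; rewrite ij [LHS](@row_mxEr _ 1 1 n).
have VM S : volume S = M0 (e' @^-1` S).
  rewrite /=; apply: eq_integral => x _; rewrite eV; congr (m _).
  by apply/seteqP; split=> t /=; rewrite /xsection /= inE.
have [M ME] : exists M : {sigma_finite_measure set (measurableTypeR R * T)%type -> \bar R},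
    M = M0 :> (set _ -> \bar R).
  (* Cubes of integer radius exhaust the space and have finite volume. *)
  apply: sigma_finite_pack; exists (fun N => e' @^-1` cube 0 N%:R).
    apply/esym; rewrite -subTset => z _.
    pose N := Num.bound (\sum_i `|e' z 0 i|); exists N => // i /=.
    rewrite [X in _ - X]mxE subr0.
    apply/ltW/(le_lt_trans _ (archi_boundP _)); last exact: sumr_ge0.
    by rewrite (bigD1 i) //= lerDl sumr_ge0.
  move=> N; rewrite -VM volume_cube ?ltry //; split=> //; exact: measurable_cube.
by constructor; apply: (@VolumeModel n.+1 _ _ M e' e'm) => S; rewrite VM ME.
Qed.

End Volume.

(** * Integrals of bounded measurable functions with bounded support *)

Section Integration.
Variables (R : realType) (n : nat) (M : volume_model R n).
Local Notation e := (@vm_pt R n M).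
Local Notation mu := (@vm_measure R n M).
Implicit Types (f g : 'rV[R]_n -> R) (S : set 'rV[R]_n).

Definition measurable_pt S := measurable (e @^-1` S).

Definition bounded_integrand f := measurable_fun setT (f \o e) /\
  exists L C, forall x, `|f x| <= C * \1_(cube 0 L) x.

Definition Int f : R := \int[mu]_t f (e t).

Lemma cube_sub (r r' : R) : r <= r' -> cube (0 : 'rV[R]_n) r `<=` cube 0 r'.
Proof. by move=> rr' x xr i; exact: le_trans (xr i) rr'. Qed.

Lemma measurable_pt_cube x0 (r : R) : measurable_pt (cube x0 r).
Proof. by apply: measurable_cube; exact: vm_coord. Qed.

Lemma measurable_pt_le f g : measurable_fun setT (f \o e) ->
  measurable_fun setT (g \o e) -> measurable_pt [set x | f x <= g x].
Proof.
by move=> mf mg; rewrite /measurable_pt -[X in measurable X]setTI; exact: measurable_fun_le.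
Qed.

Lemma measurable_fun_dot a : measurable_fun setT (dot a \o e).
Proof.
rewrite (_ : _ \o _ = (fun t => \sum_(i < n) a 0 i * e t 0 i)) //.
apply: measurable_sum => i; apply: measurable_funM => //; exact: vm_coord.
Qed.

Lemma measurable_fun_aff (I : finType) (q : I -> 'rV[R]_n) c i :
  measurable_fun setT (aff q c i \o e).
Proof.
rewrite (_ : _ \o _ = (fun t => dot (q i) (e t) + c i)).
  by apply: measurable_funD => //; exact: measurable_fun_dot.
by apply/funext => t /=; rewrite /aff dotC.
Qed.

Lemma measurable_fun_pmax (I : finType) (i0 : I) (q : I -> 'rV[R]_n) c :
  measurable_fun setT (pmax i0 q c \o e).
Proof.
have -> : pmax i0 q c \o e =
    fun t => \big[Num.max/aff q c i0 (e t)]_i aff q c i (e t).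
  apply/funext => t /=; apply/eqP; rewrite eq_le; apply/andP; split.
    by apply: pmax_le => i; apply: le_bigmax.
  by apply: bigmax_le => [|i _]; exact: aff_le_pmax.
elim: (index_enum I) => [|i s IH].
  under eq_fun do rewrite big_nil; exact: measurable_fun_aff.
under eq_fun do rewrite big_cons.
by apply: measurable_maxr => //; exact: measurable_fun_aff.
Qed.

Lemma le_volume S S' : measurable_pt S -> measurable_pt S' -> S `<=` S' ->
  (volume S <= volume S')%E.
Proof.
move=> mS mS' SS'; rewrite !(vm_volume M); apply: le_measure; rewrite ?inE //.
by move=> t; exact: SS'.
Qed.

Lemma volume_cube_fin x0 (r : R) : (volume (cube (x0 : 'rV[R]_n) r) < +oo)%E.
Proof.
have [r0|r0] := leP 0 r; first by rewrite volume_cube // ltry.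
apply: le_lt_trans (_ : (volume (cube x0 0%R) < +oo)%E); last first.
  by rewrite volume_cube // ltry.
apply: le_volume; try exact: measurable_pt_cube.
by move=> t xr i; apply: le_trans (xr i) (ltW r0).
Qed.

Lemma bounded_volume_fin S L : measurable_pt S -> S `<=` cube 0 L ->
  (volume S < +oo)%E.
Proof.
move=> mS SL; apply: le_lt_trans (volume_cube_fin 0 L).
by apply: le_volume => //; exact: measurable_pt_cube.
Qed.

Lemma bounded_integrand_indic S L : measurable_pt S -> S `<=` cube 0 L ->
  bounded_integrand (\1_S : 'rV[R]_n -> R).
Proof.
move=> mS SL; split.
  by rewrite (_ : _ \o _ = \1_(e @^-1` S)) //; exact: measurable_indic.
exists L, 1 => x; rewrite mul1r !indicE ger0_norm ?ler0n // ler_nat.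
by have [/set_mem/SL/mem_set ->|] := boolP (x \in S); last by case: (_ \in _).
Qed.

Lemma bounded_integrand_integrable f : bounded_integrand f ->
  mu.-integrable setT (EFin \o (f \o e)).
Proof.
move=> [mf [L [C fC]]].
apply: (@le_integrable _ _ _ mu setT measurableT _
  (fun t => C%:E * (\1_(e @^-1` cube 0 L) t)%:E)%E).
- exact/measurable_EFinP.
- move=> t _; rewrite /= lee_fin; apply: le_trans (fC _) _.
  by rewrite ler_norm.
- apply: integrableZl => //.
  rewrite (_ : (fun _ => _) = (fun t => (\1_(e @^-1` cube 0 L) t)%:E)) //.
  apply/integrableP; split.
    exact/measurable_EFinP/measurable_indic/measurable_pt_cube.
  under eq_integral do rewrite gee0_abs ?lee_fin //.
  rewrite integral_indic ?setIT //; last exact: measurable_pt_cube.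
  rewrite -[X in (X < _)%E]vm_volume; exact: volume_cube_fin.
Qed.

Lemma bounded_integrandD f g : bounded_integrand f -> bounded_integrand g ->
  bounded_integrand (fun x => f x + g x).
Proof.
move=> [mf [L [C fC]]] [mg [L' [C' gC]]]; split; first exact: measurable_funD.
exists (Num.max L L'), (`|C| + `|C'|) => x; apply: le_trans (ler_normD _ _) _.
have mono (D K : R) : K <= Num.max L L' ->
    D * \1_(cube 0 K) x <= `|D| * \1_(cube 0 (Num.max L L')) x.
  move=> KL; apply: (@le_trans _ _ (`|D| * \1_(cube 0 K) x)).
    by apply: ler_wpM2r; rewrite ?ler_norm // indicE ler0n.
  rewrite ler_wpM2l // !indicE ler_nat.
  have [/set_mem/(cube_sub KL)/mem_set ->//|] := boolP (x \in cube 0 K).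
  by case: (_ \in _).
rewrite mulrDl lerD //.
  by apply: le_trans (fC x) _; apply: mono; rewrite le_max lexx.
by apply: le_trans (gC x) _; apply: mono; rewrite le_max lexx orbT.
Qed.

Lemma bounded_integrandZ (l : R) f : bounded_integrand f ->
  bounded_integrand (fun x => l * f x).
Proof.
move=> [mf [L [C fC]]]; split; first exact: measurable_funM.
by exists L, (`|l| * C) => x; rewrite normrM -mulrA ler_wpM2l.
Qed.

Lemma bounded_integrand_sum (I : Type) (s : seq I) (f : I -> 'rV[R]_n -> R) :
  (forall i, bounded_integrand (f i)) ->
  bounded_integrand (fun x => \sum_(i <- s) f i x).
Proof.
move=> fb; elim: s => [|i s IH].
  split.
    by rewrite (_ : _ \o _ = cst 0) //; apply/funext => t; rewrite /= big_nil.
  by exists 0, 0 => x; rewrite big_nil normr0 mul0r.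
rewrite (_ : (fun _ => _) = (fun x => f i x + \sum_(j <- s) f j x)).
  exact: bounded_integrandD.
by apply/funext => x; rewrite big_cons.
Qed.

Lemma IntD f g : bounded_integrand f -> bounded_integrand g ->
  Int (fun x => f x + g x) = Int f + Int g.
Proof.
move=> /bounded_integrand_integrable ? /bounded_integrand_integrable ?.
exact: RintegralD.
Qed.

Lemma IntZ (l : R) f : bounded_integrand f -> Int (fun x => l * f x) = l * Int f.
Proof. by move=> /bounded_integrand_integrable ?; exact: RintegralZl. Qed.

Lemma Int_sum (I : Type) (s : seq I) (f : I -> 'rV[R]_n -> R) :
  (forall i, bounded_integrand (f i)) ->
  Int (fun x => \sum_(i <- s) f i x) = \sum_(i <- s) Int (f i).
Proof.
move=> fb; elim: s => [|i s IH].
  rewrite [RHS]big_nil /Int (_ : (fun _ => _) = cst 0).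
    by rewrite Rintegral_cst // mul0r.
  by apply/funext => t; rewrite big_nil.
rewrite big_cons -IH -IntD //; last exact: bounded_integrand_sum.
by congr Int; apply/funext => x; rewrite big_cons.
Qed.

Lemma le_Int f g : bounded_integrand f -> bounded_integrand g ->
  (forall x, f x <= g x) -> Int f <= Int g.
Proof.
move=> /bounded_integrand_integrable ? /bounded_integrand_integrable ? fg.
exact: le_Rintegral.
Qed.

Lemma Int_ge0 f : (forall x, 0 <= f x) -> 0 <= Int f.
Proof. by move=> f0; apply: Rintegral_ge0 => t _. Qed.

Lemma Int_indic S L : measurable_pt S -> S `<=` cube 0 L ->
  Int \1_S = fine (volume S).
Proof.
move=> mS SL; congr fine; rewrite (vm_volume M).
by rewrite [LHS](@integral_indic _ _ _ mu _ measurableT (e @^-1` S)) ?setIT.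
Qed.

Lemma cube_in_cube0 (x0 : 'rV[R]_n) (r : R) : exists L, cube x0 r `<=` cube 0 L.
Proof.
exists (r + \sum_i `|x0 0 i|) => x xr i; rewrite [X in _ - X]mxE subr0.
rewrite -[x 0 i](subrK (x0 0 i)); apply: (le_trans (ler_normD _ _)).
by rewrite lerD // (bigD1 i) //= lerDl sumr_ge0.
Qed.

Lemma Int_gt0 f x0 (r eta : R) : bounded_integrand f -> (forall x, 0 <= f x) ->
  0 < r -> 0 < eta -> (forall x, cube x0 r x -> eta <= f x) -> 0 < Int f.
Proof.
move=> bf f0 r0 eta0 feta; have [L cL] := cube_in_cube0 x0 r.
have bc := bounded_integrand_indic (@measurable_pt_cube x0 r) cL.
apply: (@lt_le_trans _ _ (Int (fun x => eta * \1_(cube x0 r) x))).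
  rewrite IntZ // (Int_indic (@measurable_pt_cube x0 r) cL) volume_cube ?(ltW r0) //=.
  by rewrite mulr_gt0 // exprn_gt0 // mulr_gt0.
apply: le_Int => //; first exact: bounded_integrandZ.
move=> x; rewrite indicE; have [/set_mem/feta|_] := boolP (x \in _).
  by rewrite mulr1.
by rewrite mulr0.
Qed.

Lemma negligible_exists (J : finType) (A : J -> set (vm_type M)) :
  (forall j, mu.-negligible (A j)) -> mu.-negligible [set t | exists j, A j t].
Proof.
move=> nA; apply: negligibleS (_ : mu.-negligible
  (\big[setU/set0]_(j <- index_enum J) A j)).
  by move=> t [j Ajt]; rewrite -bigcup_seq; exists j => //=; rewrite mem_index_enum.
by elim/big_ind: _ => //; [exact: negligible_set0|move=> ? ?; exact: negligibleU].
Qed.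

Definition slabs (J : finType) (a : J -> 'rV[R]_n) (b : J -> R) (L r : R) :=
  cube 0 L `&` [set x | exists j, `|dot (a j) x - b j| <= r].

Lemma measurable_pt_slabs (J : finType) (a : J -> 'rV[R]_n) b L r :
  measurable_pt (slabs a b L r).
Proof.
apply: measurableI; first exact: measurable_pt_cube.
apply: (@measurable_exists _ _ J
  (fun j => e @^-1` [set x | `|dot (a j) x - b j| <= r])) => j.
apply: (@measurable_pt_le (fun x => `|dot (a j) x - b j|) (cst r));
  last exact: measurable_cst.
apply: measurableT_comp; first exact: normr_measurable.
by apply: measurable_funB => //; exact: measurable_fun_dot.
Qed.

(** As the width tends to 0, the slabs decrease to a part of finitely many hyperplanes, a null set.
    Continuity of the measure from above applies because the cube has finite volume. *)
Lemma small_slabs (J : finType) (a : J -> 'rV[R]_n) b L (d : R) :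
  (forall j, a j != 0) -> 0 < d ->
  exists2 r, 0 < r & fine (volume (slabs a b L r)) <= d.
Proof.
move=> a0 d0; pose F (N : nat) := e @^-1` slabs a b L N.+1%:R^-1.
have Foo N : (mu (F N) < +oo)%E.
  rewrite -[X in (X < _)%E]vm_volume.
  apply: (@bounded_volume_fin _ L); first exact: measurable_pt_slabs.
  by move=> x [].
have mF N : measurable (F N) by exact: measurable_pt_slabs.
have mI : measurable (\bigcap_N F N) by exact: bigcapT_measurable.
have muI : mu (\bigcap_N F N) = 0%E.
  apply: measure_negligible => //.
  apply: negligibleS (negligible_exists
    (A := fun j => e @^-1` [set x | dot (a j) x = b j]) _); last first.
    move=> j; apply/negligibleP; last first.
      by rewrite -[LHS]vm_volume volume_hyperplane.
    rewrite (_ : _ @^-1` _ = e @^-1` [set x | dot (a j) x <= b j] `&`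
      e @^-1` [set x | b j <= dot (a j) x]).
      by apply: measurableI; [apply: (@measurable_pt_le (dot (a j)) (cst (b j)))|
        apply: (@measurable_pt_le (cst (b j)) (dot (a j)))];
        first [exact: measurable_fun_dot|exact: measurable_cst].
    apply/seteqP; split=> t /=; first by move=> ->.
    by move=> [tb bt]; apply/eqP; rewrite eq_le tb.
  move=> t Ft /=; apply/not_existsP => nt.
  pose r j := `|dot (a j) (e t) - b j|.
  have r0 j : 0 < r j by rewrite normr_gt0 subr_eq0; apply/eqP; exact: nt.
  have [N rN] : exists N, forall j, N.+1%:R^-1 < r j.
    (* A point off all hyperplanes leaves the slabs once the inverse width exceeds the sum of its
       inverse distances. *)
    pose s := \sum_j (r j)^-1; exists (Num.bound s) => j.
    have ri0 i : 0 <= (r i)^-1 by rewrite invr_ge0 ltW.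
    rewrite -[ltRHS]invrK ltf_pV2 ?posrE ?invr_gt0 //.
    have : s < (Num.bound s)%:R by rewrite archi_boundP ?sumr_ge0.
    have : (r j)^-1 <= s by rewrite /s (bigD1 j) //= lerDl sumr_ge0.
    by rewrite -natr1; lra.
  have [_ [j]] := Ft N I; rewrite -/(r j) => jN.
  by have := lt_le_trans (rN j) jN; rewrite ltxx.
have : mu \o F @ \oo --> mu (\bigcap_N F N).
  apply: nonincreasing_cvg_mu; [exact: Foo|exact: mF|exact: mI|move=> N N' NN'].
  apply/subsetPset => t [Lt [j jr]]; split=> //; exists j.
  by apply: le_trans jr _; rewrite lef_pV2 ?posrE // ler_nat ltnS.
rewrite muI => /fine_cvgP[_ /cvgrPdist_lt/(_ d d0)[N _ /(_ N (leqnn N))]].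
rewrite /= sub0r normrN => muN; exists N.+1%:R^-1; first by rewrite invr_gt0.
rewrite (vm_volume M); apply: le_trans (ltW muN); exact: ler_norm.
Qed.

End Integration.

(** * The variational principle *)

Section Lipschitz.
Variable R : realType.

Lemma near_norm_le (V : normedModType R) (x : V) (d : R) : 0 < d ->
  \forall y \near x, `|x - y| <= d.
Proof. by move=> d0; apply/nbhs_normP; exists d => //= y; exact: ltW. Qed.

Lemma lipschitz_continuous (f : R -> R) (K : R) :
  (forall s t, `|f s - f t| <= K * `|s - t|) -> continuous f.
Proof.
move=> fK s; apply/cvgrPdist_le => eps eps0.
have K0 : 0 < `|K| + 1 by rewrite ltr_wpDl.
near=> t; apply: le_trans (fK _ _) _.
apply: (@le_trans _ _ ((`|K| + 1) * `|s - t|)).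
  by rewrite ler_wpM2r // (le_trans (ler_norm K)) // lerDl.
rewrite mulrC -ler_pdivlMr //; near: t.
by apply: cvgr_dist_le; [exact: cvg_id|rewrite divr_gt0].
Unshelve. all: by end_near. Qed.

Lemma exists_between_notin (a b : R) (s : seq R) : a < b ->
  exists2 x, a < x < b & x \notin s.
Proof.
elim: s a b => [|y s IH] a b ab; first by exists ((a + b) / 2) => //; lra.
have [/andP[ay yb]|yNab] := boolP (a < y < b).
  have [x /andP[ax xy] xs] := IH _ _ ay; exists x; first by rewrite ax (lt_trans xy).
  by rewrite inE negb_or xs lt_eqF.
have [x xab xs] := IH _ _ ab; exists x => //; rewrite inE negb_or xs andbT.
by apply: contraNneq yNab => <-.
Qed.

(** Otherwise all values between [f 0] and [f 1] would be taken, and some of them avoid the finite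
    list. *)
Lemma finite_range_const (f : R -> R) (s : seq R) : continuous f ->
  (forall t, f t \in s) -> f 0 = f 1.
Proof.
move=> fc fs; apply/eqP/contraT => f01.
have [x xI /negP[]] :
    exists2 x, Num.min (f 0) (f 1) < x < Num.max (f 0) (f 1) & x \notin s.
  apply: exists_between_notin; move: f01; rewrite neq_lt lt_max !gt_min.
  by rewrite !ltxx /= orbF => /orP[] ->; rewrite ?orbT.
have [t _ <-] : exists2 t, t \in `[0, 1] & f t = x.
  apply: IVT => //; first exact: continuous_subspaceT.
  by case/andP: xI => /ltW -> /ltW ->.
exact: fs.
Qed.

Lemma cube_dot n (x y a : 'rV[R]_n) (r : R) : cube x r y ->
  `|dot a y - dot a x| <= r * \sum_i `|a 0 i|.
Proof.
move=> xy; rewrite -dotBr mulr_sumr; apply: (le_trans (ler_norm_sum _ _ _)).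
by apply: ler_sum => i _; rewrite normrM mulrC !mxE ler_wpM2r.
Qed.

Section Pmax.
Variables (n : nat) (I : finType) (i0 : I) (q : I -> 'rV[R]_n) (c : I -> R).

(** A Lipschitz constant for the sup norm, common to all the affine functions and hence valid for
    their maximum. *)
Definition cube_bound : R := \sum_i \sum_l `|q i 0 l|.

Lemma cube_aff i x y r : 0 <= r -> cube x r y ->
  `|aff q c i y - aff q c i x| <= r * cube_bound.
Proof.
move=> r0 xy; rewrite /aff opprD addrACA subrr addr0 !(dotC _ (q i)).
apply: le_trans (cube_dot (q i) xy) _; rewrite ler_wpM2l //.
by rewrite /cube_bound (bigD1 i) //= lerDl sumr_ge0 // => j _; exact: sumr_ge0.
Qed.

Lemma pmax_dist (B : R) x y : (forall i, `|aff q c i y - aff q c i x| <= B) ->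
  `|pmax i0 q c y - pmax i0 q c x| <= B.
Proof.
move=> xy; rewrite ler_norml; apply/andP; split.
  rewrite lerBrDr addrC lerBlDr; apply: pmax_le => i.
  have := aff_le_pmax i0 q c i y; have := xy i; rewrite ler_norml; lra.
rewrite lerBlDr; apply: pmax_le => i.
have := aff_le_pmax i0 q c i x; have := xy i; rewrite ler_norml; lra.
Qed.

Lemma cube_pmax x y r : 0 <= r -> cube x r y ->
  `|pmax i0 q c y - pmax i0 q c x| <= r * cube_bound.
Proof. by move=> r0 xy; apply: pmax_dist => i; exact: cube_aff. Qed.

Lemma pmax_line_continuous x z : continuous (fun s : R => pmax i0 q c (x + s *: z)).
Proof.
apply: (@lipschitz_continuous _ (\sum_i `|dot z (q i)|)) => s t.
apply: pmax_dist => i; rewrite !affB !dotZl opprD addrACA subrr add0r -mulrBl.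
rewrite normrM mulrC ler_wpM2r //.
by rewrite (bigD1 i) //= lerDl sumr_ge0.
Qed.

End Pmax.
End Lipschitz.

(** * Derivative, convexity and minimum of the energy *)

Section Energy.
Variables (R : realType) (n m k : nat).
Variables (v : 'I_m -> 'rV[R]_n) (g : 'I_m -> R) (p : 'I_k -> 'rV[R]_n).
Variables (i0 : 'I_m) (A : 'I_k -> R).
Implicit Types (h u : 'rV[R]_k) (x y : 'rV[R]_n) (j : 'I_k).

Definition site (i : 'I_k + 'I_m) : 'rV[R]_n :=
  match i with inl j => p j | inr i => v i end.

(** Unknown heights at [inl], prescribed ones at [inr]. The sign of [g] reflects that the dual takes
    minus the height as its value at an active site. *)
Definition height h (i : 'I_k + 'I_m) : R :=
  match i with inl j => h 0 j | inr i => - g i end.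

Definition increment u (i : 'I_k + 'I_m) : R := if i is inl j then u 0 j else 0.

Lemma increment_le u (t : R) i : 0 <= t -> (forall j, `|u 0 j| <= t) ->
  `|increment u i| <= t.
Proof. by case: i => [j|i] t0 ut //=; rewrite normr0. Qed.

Local Notation phi h := (pmax (inr i0) site (height h)).
Local Notation phiv := (pmax i0 v (fun i => - g i)).
Local Notation act h := (active (inr i0) site (height h)).
Local Notation affh h := (aff site (height h)).

Lemma max_affineE h : max_affine v g p h = (fun x => (phi h x)%:E).
Proof.
apply/funext => x; apply/eqP; rewrite eq_le; apply/andP; split.
  rewrite /max_affine ge_max; apply/andP; split; apply: bigmax_le; rewrite ?leNye //.
    by move=> j _; rewrite lee_fin; exact: (aff_le_pmax _ site (height h) (inl j)).
  by move=> i _; rewrite lee_fin; exact: (aff_le_pmax _ site (height h) (inr i)).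
have [[j|i] hx] := active_exists (inr i0) site (height h) x.
  rewrite (active_pmax hx) /max_affine le_max; apply/orP; left.
  exact: (le_bigmax _ (fun j => (dot x (p j) + h 0 j)%:E) j).
rewrite (active_pmax hx) /max_affine le_max; apply/orP; right.
exact: (le_bigmax _ (fun i => (dot x (v i) - g i)%:E) i).
Qed.

Lemma cellE h j : cell v g p h j = [set x | act h x (inl j)].
Proof.
rewrite /cell max_affineE; apply/seteqP; split=> x /=.
  by move=> /eqP; rewrite eqe /active eq_sym.
by move=> /active_pmax ->.
Qed.

Lemma phi_ge h x : phiv x <= phi h x.
Proof. by apply: pmax_le => i; exact: (aff_le_pmax _ site (height h) (inr i)). Qed.

Lemma phi_le h x (B : R) : (forall j, dot x (p j) + h 0 j <= B) -> phiv x <= B ->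
  phi h x <= B.
Proof.
move=> hB vB; apply: pmax_le => -[j|i]; first exact: hB.
exact: le_trans (aff_le_pmax i0 v (fun i => - g i) i x) vB.
Qed.

Lemma affD h u i x : affh (h + u) i x = affh h i x + increment u i.
Proof. by case: i => [j|i]; rewrite /aff /increment /= ?mxE ?addrA ?addr0. Qed.

Lemma aff_comb h u (t : R) i x : affh (t *: h + (1 - t) *: u) i x =
  t * affh h i x + (1 - t) * affh u i x.
Proof. by case: i => [j|i]; rewrite /aff /= ?mxE; ring. Qed.

Lemma phi_convex h u (t : R) x : 0 <= t <= 1 ->
  phi (t *: h + (1 - t) *: u) x <= t * phi h x + (1 - t) * phi u x.
Proof.
move=> /andP[t0 t1]; apply: pmax_le => i; rewrite aff_comb.
have := aff_le_pmax (inr i0) site (height h) i x.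
have := aff_le_pmax (inr i0) site (height u) i x; nra.
Qed.

Definition sup_bound h : R := \sum_j `|h 0 j|.

Lemma sup_bound_ge0 h : 0 <= sup_bound h.
Proof. exact: sumr_ge0. Qed.

Lemma le_sup_bound h j : `|h 0 j| <= sup_bound h.
Proof. by rewrite /sup_bound (bigD1 j) //= lerDl sumr_ge0. Qed.

Variables (r G : R).
Hypothesis r_gt0 : 0 < r.
Hypothesis G_ge0 : 0 <= G.
(** Interiority of the [p j] in quantitative form, [r] being the size of a cube around each of them
    inside the polytope. It confines the influence of the [p j] on the maximum to a cube. *)
Hypothesis far : forall j x (l : 'I_n), dot x (p j) + r * `|x 0 l| <= phiv x + G.
Hypothesis n_gt0 : (0 < n)%N.
Hypothesis site_inj : injective site.

Definition radius (b : R) := (b + G + 1) / r.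

Lemma far_cube h b x : (forall j, h 0 j <= b) -> ~ cube 0 (radius b) x ->
  forall j, affh h (inl j) x < phiv x.
Proof.
move=> hb /existsNP[l]; rewrite [X in _ - X]mxE subr0 => /negP; rewrite -ltNge => xl j.
have := far j x l; have := hb j; move: xl; rewrite /radius ltr_pdivrMr // /aff /=.
by rewrite mulrC; lra.
Qed.

Lemma far_phi h b x : (forall j, h 0 j <= b) -> ~ cube 0 (radius b) x ->
  phi h x = phiv x.
Proof.
move=> hb xb; apply/eqP; rewrite eq_le phi_ge andbT; apply: phi_le => // j.
exact: ltW (far_cube hb xb j).
Qed.

Lemma act_cube h b j : (forall j, h 0 j <= b) ->
  [set x | act h x (inl j)] `<=` cube 0 (radius b).
Proof.
move=> hb x hx; apply: contrapT => /(far_cube hb)/(_ j); rewrite -(active_pmax hx).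
by rewrite ltNge phi_ge.
Qed.

Variable M : volume_model R n.

Lemma bounded_phi h : bounded_integrand M (fun x => phi h x - phiv x).
Proof.
split; first by apply: measurable_funB; exact: measurable_fun_pmax.
have hb j : h 0 j <= sup_bound h by exact: le_trans (ler_norm _) (le_sup_bound h j).
exists (radius (sup_bound h)), (sup_bound h + G) => x; rewrite indicE.
have [xc|xc] := boolP (x \in _); last first.
  rewrite mulr0 (far_phi hb) ?subrr ?normr0 // => xc'.
  by move: xc; rewrite mem_set.
rewrite mulr1 ger0_norm ?subr_ge0 ?phi_ge // lerBlDr; apply: phi_le => [j|].
  have [l _] : exists l : 'I_n, True by exists (Ordinal n_gt0).
  have := far j x l; have := hb j.
  have : 0 <= r * `|x 0 l| by rewrite mulr_ge0 ?(ltW r_gt0).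
  lra.
by rewrite lerDr addr_ge0 ?sup_bound_ge0.
Qed.

Lemma measurable_act h i : measurable_pt M [set x | act h x i].
Proof.
rewrite (_ : mkset _ = [set x | phi h x <= affh h i x]).
  by apply: measurable_pt_le; [exact: measurable_fun_pmax|exact: measurable_fun_aff].
apply/seteqP; split=> x /=; first by rewrite /active => /eqP ->.
by move=> hx; rewrite /active eq_le aff_le_pmax.
Qed.

Lemma act_bounded h j : exists L, [set x | act h x (inl j)] `<=` cube 0 L.
Proof.
exists (radius (sup_bound h)); apply: act_cube => i.
exact: le_trans (ler_norm _) (le_sup_bound h i).
Qed.

Lemma bounded_act h j :
  bounded_integrand M (\1_[set x | act h x (inl j)] : 'rV[R]_n -> R).
Proof.
have [L hL] := act_bounded h j.
exact: bounded_integrand_indic (@measurable_act _ _) hL.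
Qed.

Definition cell_volume h j : R := fine (volume (cell v g p h j)).

Lemma cell_volumeE h j : cell_volume h j = Int M (\1_[set x | act h x (inl j)]).
Proof.
have [L hL] := act_bounded h j; rewrite /cell_volume cellE.
by rewrite (Int_indic (@measurable_act _ _) hL).
Qed.

Lemma volume_cellE h j : volume (cell v g p h j) = (cell_volume h j)%:E.
Proof.
rewrite /cell_volume fineK // ge0_fin_numE ?volume_ge0 //.
have [L hL] := act_bounded h j; rewrite cellE.
exact: bounded_volume_fin (@measurable_act _ _) hL.
Qed.

Definition energy h : R :=
  Int M (fun x => phi h x - phiv x) - \sum_j A j * h 0 j.

Lemma phi_diff_bound h u (t : R) x : (forall j, `|u 0 j| <= t) -> 0 <= t ->
  `|phi (h + u) x - phi h x| <= t.
Proof.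
move=> ut t0.
have ui i := @increment_le u t i t0 ut.
rewrite ler_norml; apply/andP; split.
  rewrite lerBrDr addrC lerBlDr; apply: pmax_le => i.
  have := aff_le_pmax (inr i0) site (height (h + u)) i x.
  by rewrite affD; have := ui i; rewrite ler_norml; lra.
rewrite lerBlDr; apply: pmax_le => i; rewrite affD.
have := aff_le_pmax (inr i0) site (height h) i x.
by have := ui i; rewrite ler_norml; lra.
Qed.

(** A finite index type for the hyperplanes of ties; their normals are nonzero because [site] is
    injective. *)
Definition site_pair := {ij : ('I_k + 'I_m) * ('I_k + 'I_m) | ij.1 != ij.2}.

Definition gap_normal (ij : site_pair) := site (val ij).1 - site (val ij).2.
Definition gap_level h (ij : site_pair) := height h (val ij).2 - height h (val ij).1.

Lemma gap_normal_neq0 ij : gap_normal ij != 0.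
Proof.
case: ij => -[i i'] /= ii'; rewrite /gap_normal /= subr_eq0.
by apply: contra ii' => /eqP/site_inj ->.
Qed.

Lemma gap_dist h ij x : dot (gap_normal ij) x - gap_level h ij =
  affh h (val ij).1 x - affh h (val ij).2 x.
Proof. by rewrite /gap_normal /gap_level /aff dotBl !(dotC x); ring. Qed.

(* Away from the slabs where two of the affine functions nearly agree, the
   function attaining the maximum does not change under a small variation of h. *)
Lemma phi_increment h u (t s : R) x :
  (forall j, `|u 0 j| <= t) -> 0 <= t -> 2 * t <= s -> t <= 1 ->
  `|phi (h + u) x - phi h x - \sum_j u 0 j * \1_[set x | act h x (inl j)] x|
  <= (k.+1%:R * t) *
     \1_(slabs gap_normal (gap_level h) (radius (sup_bound h + 1)) s) x.
Proof.
move=> ut t0 ts t1; set W := slabs _ _ _ _.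
have hb j : h 0 j <= sup_bound h + 1.
  by rewrite ler_wpDr //; exact: le_trans (ler_norm _) (le_sup_bound h j).
have hub j : (h + u) 0 j <= sup_bound h + 1.
  rewrite mxE lerD //; first exact: le_trans (ler_norm _) (le_sup_bound h j).
  by apply: le_trans t1; apply: le_trans (ut j); exact: ler_norm.
(* In the slabs crude bounds do: [t] for the difference of the maxima and [t] for each of the [k]
   summands. *)
have [xW|xW] := boolP (x \in W).
  rewrite [X in _ * X]indicE xW mulr1; apply: (le_trans (ler_normB _ _)).
  rewrite -natr1 addrC mulrDl mul1r lerD //; last exact: phi_diff_bound.
  apply: (le_trans (ler_norm_sum _ _ _)).
  rewrite -[k in k%:R]card_ord -sum1_card natr_sum mulr_suml; apply: ler_sum => j _.
  rewrite normrM mul1r -[leRHS]mulr1 ler_pM //.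
  by rewrite indicE; case: (_ \in _); rewrite ?normr1 ?normr0.
rewrite [X in _ * X]indicE (negbTE xW) mulr0 normr_le0 subr_eq0; apply/eqP.
have [xc|xc] := pselect (cube 0 (radius (sup_bound h + 1)) x); last first.
  rewrite (far_phi hb xc) (far_phi hub xc) subrr big1 // => j _.
  rewrite indicE memNset ?mulr0 // => /= hx.
  by apply: xc; exact: (@act_cube h _ j hb).
have gap i i' : i != i' -> s < `|affh h i x - affh h i' x|.
  move=> ii'; rewrite ltNge; apply: contra xW => gs; apply/mem_set.
  split=> //; exists (exist _ (i, i') ii' : site_pair).
  by rewrite gap_dist.
have [i ix] := active_exists (inr i0) site (height h) x.
(* In the cube but off the slabs the leader wins by more than [s]; as two functions approach each
   other by at most [2 * t], it stays the leader. *)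
have low i' : i' != i -> affh h i' x + s < affh h i x.
  move=> i'i; have := gap _ _ i'i.
  rewrite -(active_pmax ix) distrC ger0_norm ?subr_ge0; first by lra.
  exact: aff_le_pmax.
have uit i' := @increment_le u t i' t0 ut.
have iux : act (h + u) x i.
  apply/activeP => i'; rewrite !affD.
  have [->//|/low] := eqVneq i' i.
  by have := uit i; have := uit i'; rewrite !ler_norml; lra.
rewrite (active_pmax ix) (active_pmax iux) affD addrAC subrr add0r.
have hx i' : act h x i' -> i' = i.
  move=> /active_pmax; rewrite (active_pmax ix) => xi'; apply/eqP/contraT => /low.
  by rewrite -xi'; lra.
case: i ix iux low hx => [j|i] ix _ _ hx.
  rewrite (bigD1 j) //= indicE mem_set // mulr1 big1 ?addr0 // => j' j'j.
  rewrite indicE memNset ?mulr0 // => /hx[] j'E.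
  by rewrite j'E eqxx in j'j.
by rewrite big1 // => j _; rewrite indicE memNset ?mulr0 // => /hx.
Qed.

(** Differentiability with a remainder in the sup norm: continuity, the differential and the
    equations at the minimum are all read off from it. The remainder is the integral of the bound in
    [phi_increment]. *)
Lemma energy_increment h (eta : R) : 0 < eta -> exists2 d, 0 < d &
  forall u t, 0 <= t <= d -> (forall j, `|u 0 j| <= t) ->
    `|energy (h + u) - energy h - \sum_j (cell_volume h j - A j) * u 0 j| <= eta * t.
Proof.
move=> eta0; pose L := radius (sup_bound h + 1).
have kgt0 : 0 < k.+1%:R :> R by [].
(* Slab volume at most [eta / k.+1] compensates the factor [k.+1 * t] of the pointwise bound. *)
have [s s0 sW] := small_slabs M (gap_level h) L gap_normal_neq0 (divr_gt0 eta0 kgt0).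
exists (Num.min 1 (s / 2)); first by rewrite lt_min ltr01 divr_gt0.
move=> u t /andP[t0]; rewrite le_min => /andP[t1 ts] ut.
pose W := slabs gap_normal (gap_level h) L s.
have WL : W `<=` cube 0 L by move=> x [].
have mW : measurable_pt M W by exact: measurable_pt_slabs.
have bW := bounded_integrand_indic mW WL.
pose D x := phi (h + u) x - phi h x - \sum_j u 0 j * \1_[set x | act h x (inl j)] x.
pose Sx x : R := \sum_j (- u 0 j) * \1_[set x | act h x (inl j)] x.
have bS : bounded_integrand M Sx.
  by apply: bounded_integrand_sum => j; apply: bounded_integrandZ; exact: bounded_act.
have bZ h' : bounded_integrand M (fun x => (-1) * (phi h' x - phiv x)).
  by apply: bounded_integrandZ; exact: bounded_phi.
pose D1 x := (phi (h + u) x - phiv x) + (-1) * (phi h x - phiv x).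
have bD1 : bounded_integrand M D1 by apply: bounded_integrandD; [exact: bounded_phi|].
have DE : D = fun x => D1 x + Sx x.
  apply/funext => x; rewrite /D /D1 /Sx.
  rewrite [X in _ = _ + X](_ : _ = - \sum_j u 0 j * \1_[set x | act h x (inl j)] x).
    by ring.
  by rewrite -sumrN; apply: eq_bigr => j _; rewrite mulNr.
have bD : bounded_integrand M D by rewrite DE; exact: bounded_integrandD.
have -> : energy (h + u) - energy h - \sum_j (cell_volume h j - A j) * u 0 j = Int M D.
  rewrite DE IntD // /D1 IntD //; last exact: bounded_phi.
  rewrite IntZ; last exact: bounded_phi.
  rewrite Int_sum; last by move=> j; apply: bounded_integrandZ; exact: bounded_act.
  rewrite [X in _ = _ + X](_ : _ = - \sum_j cell_volume h j * u 0 j); last first.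
    rewrite -sumrN; apply: eq_bigr => j _; rewrite IntZ; last exact: bounded_act.
    by rewrite cell_volumeE mulNr mulrC.
  rewrite /energy.
  have -> : \sum_j A j * (h + u) 0 j = \sum_j A j * h 0 j + \sum_j A j * u 0 j.
    by rewrite -big_split; apply: eq_bigr => j _; rewrite mxE mulrDr.
  have -> : \sum_j (cell_volume h j - A j) * u 0 j =
      \sum_j cell_volume h j * u 0 j - \sum_j A j * u 0 j.
    by rewrite -sumrB; apply: eq_bigr => j _; rewrite mulrBl.
  ring.
have DW x : `|D x| <= (k.+1%:R * t) * \1_W x.
  by apply: phi_increment => //; move: ts; rewrite ler_pdivlMr // mulrC.
have IW : Int M (fun x => (k.+1%:R * t) * \1_W x) <= eta * t.
  rewrite IntZ // (Int_indic mW WL).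
  move: sW; rewrite -/W -/L ler_pdivlMr //; nra.
have bCW : bounded_integrand M (fun x => (k.+1%:R * t) * \1_W x).
  exact: bounded_integrandZ.
rewrite ler_norml; apply/andP; split.
  rewrite -mulN1r.
  apply: le_trans (_ : -1 * Int M (fun x => (k.+1%:R * t) * \1_W x) <= _).
    by rewrite !mulN1r lerN2.
  rewrite -IntZ //; apply: le_Int => //; first exact: bounded_integrandZ.
  by move=> x; rewrite mulN1r; have := DW x; rewrite ler_norml => /andP[].
apply: le_trans IW; apply: le_Int => // x.
by have := DW x; rewrite ler_norml => /andP[].
Qed.

(** The convexity defect at one point; the linear part of the energy cancels, so its integral is the
    convexity defect of [energy]. *)
Definition convexity_gap h u (t : R) x :=
  t * phi h x + (1 - t) * phi u x - phi (t *: h + (1 - t) *: u) x.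

Lemma convexity_gapE h u t : convexity_gap h u t = (fun x =>
  t * (phi h x - phiv x) + ((1 - t) * (phi u x - phiv x) +
    (-1) * (phi (t *: h + (1 - t) *: u) x - phiv x))).
Proof. by apply/funext => x; rewrite /convexity_gap; ring. Qed.

Lemma bounded_convexity_gap h u t : bounded_integrand M (convexity_gap h u t).
Proof.
rewrite convexity_gapE; apply: bounded_integrandD; last apply: bounded_integrandD;
  by apply: bounded_integrandZ; exact: bounded_phi.
Qed.

Lemma energy_gap h u t : Int M (convexity_gap h u t) =
  t * energy h + (1 - t) * energy u - energy (t *: h + (1 - t) *: u).
Proof.
have bp h' := bounded_phi h'; have bZ (l : R) h' := bounded_integrandZ l (bp h').
rewrite convexity_gapE IntD //; last exact: bounded_integrandD.
rewrite IntD // !IntZ // /energy.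
have -> : \sum_j A j * (t *: h + (1 - t) *: u) 0 j =
    t * (\sum_j A j * h 0 j) + (1 - t) * (\sum_j A j * u 0 j).
  by rewrite !mulr_sumr -big_split; apply: eq_bigr => j _; rewrite !mxE /=; ring.
ring.
Qed.

Lemma convexity_gap_ge0 h u t x : 0 <= t <= 1 -> 0 <= convexity_gap h u t x.
Proof. by move=> t01; rewrite subr_ge0; exact: phi_convex. Qed.

Lemma energy_convex h u t : 0 <= t <= 1 ->
  energy (t *: h + (1 - t) *: u) <= t * energy h + (1 - t) * energy u.
Proof.
move=> t01; rewrite -subr_ge0 -energy_gap.
by apply: Int_ge0 => x; exact: convexity_gap_ge0.
Qed.

Lemma convexity_gap_eq0 h u t x i : 0 < t < 1 -> convexity_gap h u t x = 0 ->
  act (t *: h + (1 - t) *: u) x i -> act h x i /\ act u x i.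
Proof.
move=> /andP[t0 t1]; rewrite /convexity_gap => gap0 /active_pmax xi.
move: gap0; rewrite xi aff_comb.
have := aff_le_pmax (inr i0) site (height h) i x.
have := aff_le_pmax (inr i0) site (height u) i x => h1 h2 h3.
split; apply/eqP; nra.
Qed.

(* Where the gap vanishes, the difference of the two maxima is one of finitely
   many values; by continuity it is then constant along any segment, but it is
   0 far away and the difference of the heights of p j inside the cell of p j. *)
Lemma convexity_gap_gt0 h u t j x0 : 0 < t < 1 -> h 0 j != u 0 j ->
  act (t *: h + (1 - t) *: u) x0 (inl j) -> exists x, 0 < convexity_gap h u t x.
Proof.
move=> t01 hu x0j; apply/not_existsP => nogap.
have t01' : 0 <= t <= 1 by case/andP: t01 => /ltW -> /ltW ->.
have gap0 x : convexity_gap h u t x = 0.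
  by apply/eqP; rewrite eq_le convexity_gap_ge0 // andbT leNgt; apply/negP/nogap.
pose s := [seq height h i - height u i | i <- index_enum ('I_k + 'I_m)%type].
have psi_s x : phi h x - phi u x \in s.
  have [i xi] := active_exists (inr i0) site (height (t *: h + (1 - t) *: u)) x.
  have [hi ui] := convexity_gap_eq0 t01 (gap0 x) xi.
  apply/mapP; exists i; first by rewrite mem_index_enum.
  by rewrite (active_pmax hi) (active_pmax ui) /aff; ring.
pose b := sup_bound h + sup_bound u.
(* A point outside the cube beyond which both maxima reduce to [phiv]. *)
pose x1 : 'rV[R]_n := const_mx (`|radius b| + 1).
have far1 h' : sup_bound h' <= b -> phi h' x1 = phiv x1.
  move=> hb; apply: (@far_phi _ b) => [i|x1b].
    exact: le_trans (le_trans (ler_norm _) (le_sup_bound h' i)) hb.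
  have := x1b (Ordinal n_gt0); rewrite !mxE subr0 ger0_norm ?addr_ge0 //.
  by have := ler_norm (radius b); lra.
pose f (a : R) := phi h (x0 + a *: (x1 - x0)) - phi u (x0 + a *: (x1 - x0)).
have : f 0 = f 1.
  apply: (@finite_range_const _ f s) => [a|a]; last exact: psi_s.
  by apply: (@cvgB _ _ _ _ _ (fun a => phi h (x0 + a *: (x1 - x0))));
    exact: pmax_line_continuous.
rewrite /f scale0r addr0 scale1r [x0 + (x1 - x0)]addrC subrK.
have [hi ui] := convexity_gap_eq0 t01 (gap0 x0) x0j.
rewrite (active_pmax hi) (active_pmax ui) !far1 ?lerDl ?lerDr ?sup_bound_ge0 //.
rewrite subrr /aff /= opprD addrACA subrr add0r => /eqP.
by rewrite subr_eq0 (negbTE hu).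
Qed.

(** A gap that is positive at one point stays positive on a cube around it, because the maxima are
    Lipschitz; so its integral is positive. *)
Lemma energy_strictly_convex h u t :
  (forall j, exists x, act (t *: h + (1 - t) *: u) x (inl j)) ->
  h <> u -> 0 < t < 1 ->
  energy (t *: h + (1 - t) *: u) < t * energy h + (1 - t) * energy u.
Proof.
move=> hne hu t01.
have [j huj] : exists j, h 0 j != u 0 j.
  apply/not_existsP => hu'; apply: hu; apply/rowP => j.
  by apply/eqP/negPn/negP; exact: hu'.
have t01' : 0 <= t <= 1 by case/andP: t01 => /ltW -> /ltW ->.
have [y yj] := hne j.
have [x x0] := convexity_gap_gt0 t01 huj yj.
rewrite -subr_gt0 -energy_gap.
pose K := cube_bound site; have K0 : 0 <= K by do 2 (apply: sumr_ge0 => ? _).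
(* The gap changes by at most [2 * rho * K], which is at most [d / 2], on the cube of radius
   [rho]. *)
pose d := convexity_gap h u t x; pose rho := d / (4 * (K + 1)).
have K1 : 0 < 4 * (K + 1) by rewrite mulr_gt0 // ltr_wpDl.
have rho0 : 0 < rho by rewrite divr_gt0.
apply: (@Int_gt0 _ _ _ _ x rho (d / 2)) => //.
- exact: bounded_convexity_gap.
- by move=> z; exact: convexity_gap_ge0.
- by rewrite divr_gt0.
have rhoK : rho * K <= d / 4.
  rewrite /rho mulrAC ler_pdivrMr // -mulrA -[d * K](mulr1) -mulrA.
  by rewrite ler_wpM2l ?(ltW x0) //; lra.
move=> z xz; rewrite /d /convexity_gap.
have near_pmax h' := cube_pmax (inr i0) site (height h') (ltW rho0) xz.
have := near_pmax h; have := near_pmax u; have := near_pmax (t *: h + (1 - t) *: u).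
rewrite !ler_norml -/K; case/andP: t01'; move: rhoK; rewrite /d /convexity_gap.
set a := phi h x; set a' := phi h z; set c := phi u x; set c' := phi u z.
set e := phi _ x; set e' := phi _ z; set B := rho * K.
move=> B1 t0 t1 /andP[e1 e2] /andP[c1 c2] /andP[a1 a2].
have : t * (a' - a) >= - t * B by nra.
have : (1 - t) * (c' - c) >= - (1 - t) * B by nra.
lra.
Qed.

(** Every point of the cell is then a tie with another site, and the ties lie on finitely many
    hyperplanes. *)
Lemma act_negligible h j : (forall x, ~ dominant site (height h) (inl j) x) ->
  volume (cell v g p h j) = 0%E.
Proof.
move=> nd; rewrite cellE (vm_volume M).
pose J := {i : 'I_k + 'I_m | i != inl j}.
apply: measure_negligible; first exact: measurable_act.
apply: negligibleS (@negligible_exists _ _ M J (fun i => @vm_pt _ _ M @^-1`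
  [set x | dot (site (inl j) - site (val i)) x = height h (val i) - h 0 j]) _).
  move=> t /= tj; apply/not_existsP => nt; apply: (nd (vm_pt t)) => i ij.
  rewrite -(active_pmax tj) lt_neqAle aff_le_pmax andbT (active_pmax tj).
  apply/eqP => tE; apply: (nt (exist _ i ij)) => /=; move: tE.
  by rewrite /aff /= dotBl !(dotC _ (vm_pt t)); lra.
move=> [i ij]; apply/negligibleP.
  rewrite (_ : _ @^-1` _ = @vm_pt _ _ M @^-1`
    ([set x | dot (site (inl j) - site i) x <= height h i - h 0 j] `&`
     [set x | height h i - h 0 j <= dot (site (inl j) - site i) x])).
    apply: measurableI.
      apply: (@measurable_pt_le _ _ M _ (cst (height h i - h 0 j)));
        [exact: measurable_fun_dot|exact: measurable_cst].
    apply: (@measurable_pt_le _ _ M (cst (height h i - h 0 j)));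
      [exact: measurable_cst|exact: measurable_fun_dot].
  apply/seteqP; split=> x /=; first by move=> ->.
  by move=> [h1 h2]; apply/eqP; rewrite eq_le h1.
rewrite -[LHS](vm_volume M) volume_hyperplane // subr_eq0.
have := ij; apply: contra => /eqP e; apply/eqP.
exact: (@site_inj i (inl j) (esym e)).
Qed.

Lemma dominant_cube h i x : dominant site (height h) i x ->
  exists2 rho, 0 < rho & forall y, cube x rho y -> dominant site (height h) i y.
Proof.
move=> xi; pose K := cube_bound site.
have K0 : 0 <= K by do 2 (apply: sumr_ge0 => ? _).
pose gap i' := affh h i x - affh h i' x.
pose e := \big[Num.min/1]_(i' | i' != i) gap i'.
have e0 : 0 < e by apply: lt_bigmin => // i' i'i; rewrite subr_gt0 xi.
have K1 : 0 < 2 * K + 1 by rewrite ltr_wpDl // mulr_ge0.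
(* Two competing functions each move by at most [K] times this radius, together by less than the
   smallest gap [e]. *)
exists (e / (2 * K + 1)) => [|y xy i' i'i]; first by rewrite divr_gt0.
have rho0 : 0 <= e / (2 * K + 1) by rewrite divr_ge0 ?(ltW e0) ?(ltW K1).
have := cube_aff site (height h) i rho0 xy.
have := cube_aff site (height h) i' rho0 xy.
have := @bigmin_le_cond _ _ _ 1 i' (fun i' => i' != i) gap i'i.
rewrite -/e -/K /gap !ler_norml.
have : e / (2 * K + 1) * (2 * K) < e.
  by rewrite mulrAC ltr_pdivrMr // ltr_pM2l // ltrDl.
set B := e / _; move=> h1 h2 /andP[h3 h4] /andP[h5 h6]; lra.
Qed.

(** A condition on volumes becomes the solvability of strict inequalities, which can be combined
    convexly. *)
Lemma admissibleP h : admissible v g p h <->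
  forall j, exists x, dominant site (height h) (inl j) x.
Proof.
split=> hA j.
  apply/not_existsP => nd; have := hA j; rewrite act_negligible ?ltxx //.
have [x xj] := hA j; have [rho rho0 xrho] := dominant_cube xj.
apply: lt_le_trans (_ : (volume (cube x rho) <= _)%E).
  by rewrite volume_cube ?(ltW rho0) // lte_fin exprn_gt0 // mulr_gt0.
rewrite cellE; apply: (le_volume (M := M)).
- exact: measurable_pt_cube.
- exact: measurable_act.
by move=> y xy /=; apply: dominant_active; exact: xrho.
Qed.

Lemma admissible_convex :
  convex_set (admissible v g p : set (convex_lmodType 'rV[R]_k)).
Proof.
apply/convex_setE => h u t /andP[t0 t1] /admissibleP hA /admissibleP uA.
apply/admissibleP => j; have [x hx] := hA j; have [y uy] := uA j.
exists (t *: x + (1 - t) *: y) => i ij; have := hx i ij; have := uy i ij.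
(* The value is jointly affine in the heights and the point. *)
have aE i' : affh (t *: h + (1 - t) *: u) i' (t *: x + (1 - t) *: y) =
    t * affh h i' x + (1 - t) * affh u i' y.
  by case: i' {ij} => [j'|i']; rewrite /aff /= dotDl !dotZl ?mxE; ring.
rewrite !aE; have [->|] := eqVneq t 0; first by lra.
by move=> tn h1 h2; have : 0 < t by [rewrite lt_neqAle eq_sym tn]; nra.
Qed.

Lemma energy_strictly_convex_admissible : strictly_convex (admissible v g p) energy.
Proof.
split; first exact: admissible_convex.
move=> h u t hA uA hu t01; apply: energy_strictly_convex => // j.
have t01' : 0 <= t <= 1 by case/andP: t01 => /ltW -> /ltW ->.
have /convex_setE/(_ h u t t01' hA uA)/admissibleP/(_ j)[x xj] := admissible_convex.
by exists x; exact: dominant_active.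
Qed.

Hypothesis A_gt0 : forall j, 0 < A j.

Lemma phi_increment_cube L : 0 <= L -> exists2 C, 0 <= C &
  forall h j x, cube 0 L x -> h 0 j - C <= phi h x - phiv x.
Proof.
move=> L0; pose z : 'rV[R]_k := 0; pose K := cube_bound site.
have K0 : 0 <= K by do 2 (apply: sumr_ge0 => ? _).
(* One [L * K] bounds the drift from the origin of the affine function of [p j], the other that of
   [phiv]. *)
exists (L * K + L * K + sup_bound z + `|phiv 0|).
  by rewrite !addr_ge0 ?mulr_ge0 ?sup_bound_ge0.
move=> h j x xL; have := aff_le_pmax (inr i0) site (height h) (inl j) x.
have := cube_aff site (height z) (inl j) L0 xL.
have vK : cube_bound v <= K.
  rewrite /K /cube_bound big_sumType /= lerDr.
  by do 2 (apply: sumr_ge0 => ? _).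
have := cube_pmax i0 v (fun i => - g i) L0 xL.
have := sup_bound_ge0 z; have := ler_norm (phiv 0).
have : L * cube_bound v <= L * K by rewrite ler_wpM2l.
rewrite -/K !ler_norml /aff /= dot0l; set B := L * _; set B' := L * K.
move=> h1 h2 h3 /andP[h4 h5] /andP[h6 h7]; move: h6 h7; rewrite !mxE; lra.
Qed.

(** Raising [h j] must cost more than the reward [A j]. On a cube of volume [V] the integrand is at
    least [h j - C]. The integral is cut into [k.+1] equal shares, one for each [j], and [V / k.+1]
    is made at least [Asum + 1]. Negative heights are penalized by [- A j * h 0 j]. *)
Lemma energy_coercive : exists2 a, 0 < a &
  exists C, forall h, a * sup_bound h - C <= energy h.
Proof.
pose Asum := \sum_j A j; have Asum0 : 0 <= Asum by apply: sumr_ge0 => j _; exact: ltW.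
have AjA j : A j <= Asum.
  by rewrite /Asum (bigD1 j) //= lerDl sumr_ge0 // => i _; exact: ltW.
pose B := k.+1%:R * (Asum + 1).
have k1 : 1 <= k.+1%:R :> R by rewrite ler1n.
have B1 : 1 <= B by rewrite /B; nra.
have B0 : 0 <= B / 2 by lra.
have [C C0 hC] := phi_increment_cube B0.
pose V := B ^+ n; have BV : B <= V.
  by rewrite /V; case: (n) n_gt0 => // n' _; rewrite exprS ler_peMr ?exprn_ege1 //; lra.
have V0 : 0 < V by lra.
have IV h j : V * (h 0 j - C) <= Int M (fun x => phi h x - phiv x).
  have [hj|hj] := leP (h 0 j - C) 0.
    apply: (@le_trans _ _ 0); first by nra.
    by apply: Int_ge0 => x; rewrite subr_ge0 phi_ge.
  have mc := measurable_pt_cube M 0 (B / 2).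
  have bc := bounded_integrand_indic mc (fun _ xc => xc).
  have <- : Int M (fun x => (h 0 j - C) * \1_(cube 0 (B / 2)) x) = V * (h 0 j - C).
    rewrite IntZ // (Int_indic mc (fun _ xc => xc)) volume_cube //=.
    by rewrite mulrC; congr (_ ^+ _ * _); field.
  apply: le_Int; [exact: bounded_integrandZ|exact: bounded_phi|move=> x].
  rewrite indicE; have [/set_mem/hC|_] := boolP (x \in _); rewrite ?mulr1 //.
  by rewrite mulr0 subr_ge0 phi_ge.
(* The growth rate is at least 1 in a positive height and at least [A j] in a negative one. *)
pose a := \big[Num.min/1]_j A j.
have a0 : 0 < a by apply: lt_bigmin.
have a1 : a <= 1 by exact: bigmin_le_id.
have aA j : a <= A j by exact: bigmin_le.
exists a => //; exists (k%:R * (V / k.+1%:R) * C) => h.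
set F := Int M (fun x => phi h x - phiv x) in IV *.
have F0 : 0 <= F by apply: Int_ge0 => x; rewrite subr_ge0 phi_ge.
have Fj j : (V / k.+1%:R) * (Num.max 0 (h 0 j) - C) <= F / k.+1%:R.
  rewrite mulrAC ler_pM2r ?invr_gt0 ?ltr0n //.
  have [hj|hj] := leP (h 0 j) 0; last exact: IV.
  by apply: le_trans F0; nra.
have Fk : \sum_j (V / k.+1%:R) * (Num.max 0 (h 0 j) - C) <= F.
  apply: (@le_trans _ _ (\sum_(j < k) F / k.+1%:R)); first by apply: ler_sum.
  rewrite sumr_const card_ord -[leLHS]mulr_natr -mulrA ler_piMr //.
  by rewrite mulrC ler_pdivrMr ?ltr0n // mul1r ler_nat.
have Vk : Asum + 1 <= V / k.+1%:R.
  by rewrite ler_pdivlMr ?ltr0n // mulrC.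
rewrite /energy -/F.
suff : a * sup_bound h - k%:R * (V / k.+1%:R) * C <=
    \sum_j (V / k.+1%:R * (Num.max 0 (h 0 j) - C) - A j * h 0 j).
  by move=> /le_trans; apply; rewrite sumrB lerD2r.
have -> : k%:R * (V / k.+1%:R) * C = \sum_(j < k) (V / k.+1%:R) * C.
  by rewrite sumr_const card_ord -[RHS]mulr_natl -[LHS]mulrA.
rewrite mulr_sumr -sumrB; apply: ler_sum => j _.
rewrite mulrBr lerBlDr addrAC subrK.
have := aA j; have := AjA j; set W := V / _ in Vk *.
have [hj|hj] := leP (h 0 j) 0.
  by rewrite ler0_norm // mulr0 sub0r; nra.
by rewrite ger0_norm ?(ltW hj) //; nra.
Qed.

Lemma coord_le_norm u j : `|u 0 j| <= `|u|.
Proof.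
rewrite {2}/Num.norm /= mx_normrE.
exact: (le_bigmax _ (fun ij => `|u ij.1 ij.2|) (0, j)).
Qed.

Lemma norm_coord_sum (c : 'I_k -> R) u :
  `|\sum_j c j * u 0 j| <= (\sum_j `|c j|) * `|u|.
Proof.
apply: (le_trans (ler_norm_sum _ _ _)); rewrite mulr_suml; apply: ler_sum => j _.
by rewrite normrM ler_wpM2l // coord_le_norm.
Qed.

Lemma energy_continuous : continuous energy.
Proof.
move=> h; apply/(@cvgrPdist_le _ _ _ (nbhs h)) => eps eps0.
have [d d0 hd] := energy_increment h ltr01.
pose C := \sum_j `|cell_volume h j - A j| + 1.
have C0 : 0 < C by rewrite ltr_wpDl // sumr_ge0.
near=> u; have uh : `|u - h| <= Num.min d (eps / C).
  rewrite distrC; near: u; apply: (@near_norm_le _ 'rV[R]_k h).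
  by rewrite lt_min d0 divr_gt0.
move: uh; rewrite le_min => /andP[uhd uhe].
have := hd (u - h) `|u - h|.
rewrite normr_ge0 uhd [h + _]addrC subrK mul1r => /(_ isT (coord_le_norm _)).
set S := \sum_j _ => uS.
have SC := norm_coord_sum (fun j => cell_volume h j - A j) (u - h).
rewrite distrC -[_ - energy h](subrK S); apply: (le_trans (ler_normD _ _)).
apply: (le_trans (lerD uS SC)); move: uhe; rewrite ler_pdivlMr //.
by rewrite /C; lra.
Unshelve. all: by end_near. Qed.

Lemma energy_minimum : exists h, forall u, energy h <= energy u.
Proof.
have [a a0 [C aC]] := energy_coercive.
(* Beyond [rho] the coercive bound exceeds [energy 0], so the minimum over the compact cube [K] is
   global. *)
pose rho := (`|energy 0| + `|C| + 1) / a.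
pose K : set 'rV[R]_k := [set u | forall j, [set` `[- rho, rho]] (u ord0 j)].
have rho0 : 0 <= rho by rewrite divr_ge0 ?(ltW a0) // !addr_ge0.
have K0 : K 0 by move=> j /=; rewrite mxE in_itv /= oppr_le0 rho0.
have cK : compact K by apply: (@rV_compact _ _ (fun=> _)) => j; exact: segment_compact.
have [h hK hmin] := EVT_min_rV (ex_intro _ _ K0) cK
  (continuous_subspaceT energy_continuous).
exists h => u; have [uK|uK] := pselect (K u); first by apply: hmin; rewrite inE.
apply: (@le_trans _ _ (energy 0)); first by apply: hmin; rewrite inE.
have /existsNP[j] := uK; rewrite /= in_itv /= -ler_norml => /negP; rewrite -ltNge.
rewrite /rho ltr_pdivrMr // => uj; have := aC u; have := le_sup_bound u j.
have := ler_norm (energy 0); have := ler_norm C; nra.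
Qed.

Lemma minimum_cell_volume h : (forall u, energy h <= energy u) ->
  forall j, cell_volume h j = A j.
Proof.
move=> hmin j; apply/eqP; rewrite -subr_eq0; apply/contraT => Gj.
pose c := cell_volume h j - A j; have c0 : 0 < `|c| / 2 by rewrite divr_gt0 ?normr_gt0.
have [d d0 hd] := energy_increment h c0.
(* A step of length [d] against the sign of the partial derivative [c] lowers the energy by at least
   half of [|c| * d]. *)
pose u : 'rV[R]_k := - (Num.sg c * d) *: delta_mx 0 j.
have uE i : u 0 i = - (Num.sg c * d) * (i == j)%:R by rewrite !mxE eqxx.
have ud i : `|u 0 i| <= d.
  rewrite uE; case: eqP => _; rewrite ?mulr1 ?mulr0 ?normr0 ?(ltW d0) //.
  by rewrite normrN normrM normr_sg Gj mul1r gtr0_norm.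
have := hd u d; rewrite (ltW d0) lexx => /(_ isT ud).
rewrite (bigD1 j) //= big1 ?addr0 => [|i ij]; last by rewrite uE (negbTE ij) !mulr0.
rewrite uE eqxx mulr1 -/c mulrN mulrA (mulrC c) -normrEsg ler_norml => /andP[_].
have cd : 0 < `|c| * d by rewrite mulr_gt0 ?normr_gt0.
by have := hmin (h + u); lra.
Qed.

(** A stationary point of a convex function is a global minimum: a lower value at [u] would force a
    linear decrease along the segment, against the first-order estimate. *)
Lemma cell_volume_minimum h : (forall j, cell_volume h j = A j) ->
  forall u, energy h <= energy u.
Proof.
move=> hA u; rewrite leNgt; apply/negP => uh; pose c := energy h - energy u.
have c0 : 0 < c by rewrite subr_gt0.
pose T := sup_bound (u - h) + 1; have T0 : 0 < T by rewrite ltr_wpDl ?sup_bound_ge0.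
(* With [eta = c / (2 * T)] the remainder at the fraction [s] of the segment is [c * s / 2], less
   than the forced decrease [c * s]. *)
have [d d0 hd] := energy_increment h (divr_gt0 c0 (mulr_gt0 (ltr0Sn R 1) T0)).
pose s := Num.min 1 (d / T).
have s0 : 0 < s by rewrite lt_min ltr01 divr_gt0.
have s1 : s <= 1 by rewrite ge_min lexx.
have sT : s * T <= d by rewrite -ler_pdivlMr // ge_min lexx orbT.
have := hd (s *: (u - h)) (s * T); rewrite sT mulr_ge0 ?(ltW s0) ?(ltW T0) //=.
rewrite big1 => [|j _]; last by rewrite hA subrr mul0r.
move=> /(_ isT) H; have /H : forall j, `|(s *: (u - h)) 0 j| <= s * T.
  move=> j; rewrite mxE normrM gtr0_norm // ler_pM2l //.
  by apply: (le_trans (le_sup_bound _ j)); rewrite lerDl.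
have -> : h + s *: (u - h) = s *: u + (1 - s) *: h.
  by rewrite scalerBr scalerBl scale1r addrCA.
have : energy (s *: u + (1 - s) *: h) <= s * energy u + (1 - s) * energy h.
  by apply: energy_convex; rewrite (ltW s0).
rewrite subr0 ler_norml => h1 /andP[h2 _].
have h3 : c / (2 * T) * (s * T) = c * s / 2 by field; rewrite gt_eqF.
have cs : 0 < c * s by rewrite mulr_gt0.
move: h1 h2; rewrite h3 /c in cs *; lra.
Qed.

Lemma energy_diff h : is_diff h energy
  (fun u => \sum_(j < k) (cell_volume h j - A j) * u 0 j).
Proof.
pose df u := \sum_(j < k) (cell_volume h j - A j) * u 0 j.
have dfl : linear (df : 'rV[R]_k -> R).
  move=> c u w; rewrite /df scaler_sumr -big_split; apply: eq_bigr => j _.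
  by rewrite !mxE /= /GRing.scale /=; ring.
pose dfM := GRing.isLinear.Build _ _ _ _ _ dfl.
pose dfL : {linear 'rV[R]_k -> R} := HB.pack df dfM.
have dfc : continuous dfL.
  move=> u; apply/(@cvgrPdist_le _ _ _ (nbhs u)) => eps eps0.
  pose C := \sum_j `|cell_volume h j - A j| + 1.
  have C0 : 0 < C by rewrite ltr_wpDl // sumr_ge0.
  near=> w; rewrite -linearB; apply: (le_trans (norm_coord_sum _ _)).
  have uw : `|u - w| <= eps / C.
    by near: w; apply: (@near_norm_le _ 'rV[R]_k u); rewrite divr_gt0.
  move: uw; rewrite ler_pdivlMr // /C; have := normr_ge0 (u - w); lra.
have := @diff_unique R 'rV[R]_k R energy dfL h dfc.
set expansion := (X in (X -> _) -> _) => dE.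
have ex : expansion.
  apply/eqaddoP => eps eps0 /=; have [d d0 hd] := energy_increment h eps0.
  near=> u; rewrite [X in `|X|](_ : _ = energy (h + u) - energy h - df u); last first.
    by rewrite /= !fctE /= opprD addrA [u + h]addrC.
  apply: hd => [|j].
    rewrite normr_ge0 /= -normrN -[- u]sub0r; near: u.
    exact: (@near_norm_le _ 'rV[R]_k 0).
  exact: coord_le_norm.
apply: DiffDef; last exact: dE.
by apply/diff_locallyP; rewrite (dE ex).
Unshelve. all: by end_near. Qed.

Lemma energy_variational : variational_function v g p A energy.
Proof. by move=> h _; exact: energy_diff. Qed.

(** As the [A j] are positive, the volume equations by themselves make [h] admissible. *)
Lemma critical_pointE h : critical_point (admissible v g p) energy h <->
  forall j, cell_volume h j = A j.
Proof.
split=> [[hA [_ hd]] j|hA]; last first.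
  split; first by move=> j; rewrite volume_cellE hA lte_fin.
  rewrite (_ : (fun=> 0) = fun u => \sum_(j < k) (cell_volume h j - A j) * u 0 j).
    exact: energy_diff.
  by apply/funext => u; rewrite big1 // => j _; rewrite hA subrr mul0r.
have [_] := energy_diff h; rewrite hd => /(congr1 (fun f => f (delta_mx 0 j))).
rewrite (bigD1 j) //= big1 => [|i ij]; last by rewrite mxE (negbTE ij) andbF mulr0.
by rewrite mxE !eqxx mulr1 addr0 => /esym/eqP; rewrite subr_eq0 => /eqP.
Qed.

Theorem energy_critical_point : exists h, (forall j, cell_volume h j = A j) /\
  forall h', critical_point (admissible v g p) energy h' <-> h' = h.
Proof.
have [h hmin] := energy_minimum; have hA := minimum_cell_volume hmin.
exists h; split=> // h'; rewrite critical_pointE; split=> [h'A|->//].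
apply: contrapT => hh'.
have adm u : (forall j, cell_volume u j = A j) -> admissible v g p u.
  by move=> uA j; rewrite volume_cellE uA lte_fin.
have [_ /(_ h' h 2^-1 (adm _ h'A) (adm _ hA) hh')] := energy_strictly_convex_admissible.
have half : ((0 : R) < 2^-1) && (2^-1 < (1 : R)) by apply/andP; split; lra.
move=> /(_ half); have := hmin (2^-1 *: h' + (1 - 2^-1) *: h).
by have := cell_volume_minimum h'A h; lra.
Qed.

End Energy.

(** * The polytope and its interior points *)

Section PolytopeWithPoints.
Variables (R : realType) (n m k : nat) (v : 'I_m -> 'rV[R]_n) (p : 'I_k -> 'rV[R]_n).
Hypothesis n_gt0 : (0 < n)%N.
Hypothesis v_extreme : forall i, ~ hull v (predC1 i) (v i).
Hypothesis p_inj : injective p.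
Hypothesis p_int : forall j, interior (hull v xpredT) (p j).

Lemma interior_cube (S : set 'rV[R]_n) x : interior S x ->
  exists2 r, 0 < r & cube x r `<=` S.
Proof.
move=> /nbhs_ballP[e /= e0 eS]; exists (e / 2); first by rewrite divr_gt0.
move=> y xy; apply: eS; split=> // i l; rewrite ord1 /ball /= distrC.
by apply: le_lt_trans (xy l) _; rewrite ltr_pdivrMr // ltr_pMr // ltr1n.
Qed.

Lemma p_cubes : exists2 r, 0 < r & forall j, cube (p j) r `<=` hull v xpredT.
Proof.
have /choice[r rP] j : exists r, 0 < r /\ cube (p j) r `<=` hull v xpredT.
  by have [r r0 rS] := interior_cube (p_int j); exists r.
exists (\big[Num.min/1]_j r j).
  by apply: lt_bigmin => // j _; have [] := rP j.
move=> j x xj; have [_] := rP j; apply=> l.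
exact: le_trans (xj l) (bigmin_le _ _ _).
Qed.

Lemma cube_delta (x : 'rV[R]_n) (r : R) l : cube x `|r| (x + r *: delta_mx 0 l).
Proof.
move=> i; rewrite !mxE addrAC subrr add0r normrM; case: (i == l); last first.
  by rewrite andbF normr0 mulr0.
by rewrite eqxx normr1 mulr1.
Qed.

Lemma dot_deltar (a : 'rV[R]_n) l : dot a (delta_mx 0 l) = a 0 l.
Proof. by rewrite dotC dot_delta. Qed.

Lemma hull_maximum i (a : 'rV[R]_n) y :
  (forall i', i' != i -> dot a (v i') < dot a (v i)) ->
  hull v xpredT y -> dot a (v i) <= dot a y -> y = v i.
Proof.
move=> ai [l [l0 _ l1 ly]] ay.
have S0 : \sum_i' l i' * (dot a (v i) - dot a (v i')) <= 0.
  suff -> : \sum_i' l i' * (dot a (v i) - dot a (v i')) = dot a (v i) - dot a y.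
    by rewrite subr_le0.
  rewrite -ly dot_sumr -[dot a (v i) in RHS]mul1r -l1 mulr_suml -sumrB.
  by apply: eq_bigr => i' _; rewrite dotZr mulrBr.
have P0 i' : true -> 0 <= l i' * (dot a (v i) - dot a (v i')).
  by have [->|/ai/ltW ii'] := eqVneq i' i; rewrite ?subrr ?mulr0 ?mulr_ge0 ?subr_ge0.
have {}S0 : \sum_i' l i' * (dot a (v i) - dot a (v i')) = 0.
  by apply/eqP; rewrite eq_le S0 sumr_ge0.
have li i' : i' != i -> l i' = 0.
  move=> i'i; have /eqP := psumr_eq0P P0 S0 (i := i') isT.
  by rewrite mulf_eq0 subr_eq0 (gt_eqF (ai _ i'i)) orbF => /eqP.
rewrite -ly (bigD1 i) //= big1 => [|i' /li ->]; last by rewrite scale0r.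
move: l1; rewrite (bigD1 i) //= big1 // => /[!addr0] ->.
by rewrite scale1r.
Qed.

(** Separation gives a direction in which [v i] beats the other vertices. If some [p j] reached its
    level, so would [p j] shifted both ways along a coordinate, and both shifted points would equal
    the unique maximizer [v i]. *)
Lemma vertex_direction i : exists a : 'rV[R]_n,
  forall s, s != inr i -> dot a (site v p s) < dot a (site v p (inr i)).
Proof.
have [a [b [ab bi]]] := hull_separation (@v_extreme i).
have ai i' : i' != i -> dot a (v i') < dot a (v i).
  by move=> i'i; exact: le_lt_trans (ab _ i'i) bi.
exists a => -[j _|i' i'i]; last by apply: ai; apply: contra i'i => /eqP ->.
rewrite /= ltNge; apply/negP => ij.
have [r r0 rS] := p_cubes; pose l := Ordinal n_gt0.
have hp (t : R) : `|t| = r -> hull v xpredT (p j + t *: delta_mx 0 l).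
  by move=> tr; apply: (rS j); rewrite -tr; exact: cube_delta.
have shift_le (t : R) : `|t| = r -> t * a 0 l <= dot a (v i) - dot a (p j).
  move=> /hp; rewrite lerBrDl -dot_deltar -dotZr -dotDr => /(hull_dot_le _); apply.
  by move=> i' _; have [->//|/ai/ltW] := eqVneq i' i.
have rr : `|r| = r by rewrite gtr0_norm.
(* Both shifts stay in the polytope; if this coordinate were nonzero, one of them would exceed the
   maximum. *)
have al0 : a 0 l = 0.
  have := shift_le r rr; have := shift_le (- r); rewrite normrN => /(_ rr).
  rewrite mulNr => h1 h2; apply/eqP; rewrite -(mulrI_eq0 _ (lregP (lt0r_neq0 r0))).
  by apply/eqP; lra.
have eq_vi t : `|t| = r -> p j + t *: delta_mx 0 l = v i.
  move=> /hp ht; apply: (hull_maximum ai ht).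
  by rewrite dotDr dotZr dot_deltar al0 mulr0 addr0.
have := eq_vi (- r); rewrite normrN -(eq_vi r rr) => /(_ rr)/addrI/rowP/(_ l).
by rewrite !mxE !eqxx !mulr1; lra.
Qed.

Lemma site_injective : injective (site v p).
Proof.
move=> s s' ss'; apply/eqP/contraT => ns.
case: s s' ss' ns => [j|i] s' ss' ns; last first.
  have [a /(_ s')] := vertex_direction i; rewrite eq_sym => /(_ ns).
  by rewrite -ss' ltxx.
case: s' ss' ns => [j'|i'] ss' ns; first by rewrite (p_inj ss') eqxx in ns.
by have [a /(_ _ ns)] := vertex_direction i'; rewrite ss' ltxx.
Qed.

Lemma hull_site : hull (site v p) xpredT = hull v xpredT.
Proof.
apply/seteqP; split=> y [l [l0 _ l1 <-]].
  apply: convex_set_sum => //; first exact: hull_convex.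
  by case=> [j|i] _; [exact: (interior_subset (p_int j))|exact: (hull_pt v (i := i))].
apply: convex_set_sum => //; first exact: hull_convex.
by move=> i _; exact: (hull_pt (site v p) (i := inr i)).
Qed.

(** The left side is the form [dot x] at [p j] shifted along coordinate [l] by [r] times the sign of
    [x 0 l]. This point is in the polytope, where a linear form is bounded by its values at the
    [v i]. *)
Lemma far_estimate (g : 'I_m -> R) (i0 : 'I_m) : exists2 r, 0 < r &
  exists2 G, 0 <= G & forall j x (l : 'I_n),
    dot x (p j) + r * `|x 0 l| <= pmax i0 v (fun i => - g i) x + G.
Proof.
have [r r0 rS] := p_cubes; exists r => //.
exists (\sum_i `|g i|) => [|j x l]; first exact: sumr_ge0.
pose t := r * Num.sg (x 0 l).
have hy : hull v xpredT (p j + t *: delta_mx 0 l).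
  apply: (rS j) => i; apply: le_trans (cube_delta (p j) t l i) _.
  by rewrite /t normrM (gtr0_norm r0) ler_piMr ?(ltW r0) // normr_sg lern1 leq_b1.
have -> : dot x (p j) + r * `|x 0 l| = dot x (p j + t *: delta_mx 0 l).
  by rewrite dotDr dotZr dot_deltar /t normrEsg mulrA.
apply: hull_dot_le hy => i _.
have := aff_le_pmax i0 v (fun i => - g i) i x; rewrite /aff.
have : g i <= \sum_i `|g i|.
  by apply: le_trans (ler_norm _) _; rewrite (bigD1 i) //= lerDl sumr_ge0.
by lra.
Qed.

End PolytopeWithPoints.

Theorem theorem1p4 (R : realType) (n m k : nat) (n_gt0 : (0 < n)%N)
  (v : 'I_m -> 'rV[R]_n) (p : 'I_k -> 'rV[R]_n)
  (Omega : set 'rV[R]_n)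
  (OmegaE : Omega = convex_hull [set v i | i in [set: 'I_m]])
  (Omega_dim : has_dim Omega n)
  (v_extreme : forall i,
     ~ convex_hull [set v i' | i' in [set i' | i' != i]] (v i))
  (p_inj : injective p)
  (p_int : forall j, interior Omega (p j))
  (g : 'I_m -> R) (A : 'I_k -> R) (A_gt0 : forall j, 0 < A j) :
  exists (T : set (set 'rV[R]_n)) (w : 'rV[R]_n -> R) (h : 'rV[R]_k),
    [/\ convex_cell_decomposition Omega T,
        (forall i, is_vertex T (v i)) /\ (forall j, is_vertex T (p j)),
        @convex_function R 'rV[R]_n Omega w /\ piecewise_linear T w,
        forall i, w (v i) = g i
      & forall j, discrete_hessian_det T w (p j) = (A j)%:E] /\
    [/\ legendre_domain (max_affine v g p h) = Omega,
        forall y, Omega y -> (w y)%:E = legendre (max_affine v g p h) y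
      &
        exists E : 'rV[R]_k -> R,
        [/\ variational_function v g p A E,
            strictly_convex (admissible v g p) E
          & forall h', critical_point (admissible v g p) E h' <-> h' = h]].
Proof.
have hullE (P : pred 'I_m) (S : set 'I_m) : (forall i, P i <-> S i) ->
    hull v P = convex_hull [set v i | i in S].
  move=> PS; rewrite hull_convex_hull; congr (convex_hull (image _ _)).
  by apply/seteqP; split=> i /PS.
have OE : Omega = hull v xpredT by rewrite OmegaE; apply/esym/hullE.
have v_ext i : ~ hull v (predC1 i) (v i).
  by rewrite (hullE _ [set i' | i' != i]) //; exact: v_extreme.
have {}p_int j : interior (hull v xpredT) (p j) by rewrite -OE.
(* A set that has a dimension is nonempty, so there is a [v i] to anchor the maximum. *)
have [i0 _] : exists i : 'I_m, True.
  have [[y]] := Omega_dim; rewrite OE => -[l [_ _ l1 _]] _.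
  apply/not_existsP => no; move/eqP: l1; rewrite big1 ?(eq_sym 0) ?oner_eq0 // => i.
  by case: (no i).
have [r r0 [G G0 far]] := far_estimate p_int g i0.
have s_inj := site_injective n_gt0 v_ext p_inj p_int.
have [M] := volume_model_exists R n.
have [h [hA h_crit]] := energy_critical_point r0 G0 far n_gt0 s_inj M A_gt0.
have suppE : support (site v p) = Omega by rewrite OE /support (hull_site p_int).
have h_adm : admissible v g p h.
  by move=> j; rewrite (volume_cellE r0 far M) hA lte_fin.
have p_dom := (admissibleP g i0 s_inj M h).1 h_adm.
(* An exposing direction makes [v i] dominant far out, whatever the heights. *)
have v_dom i : exists x, dominant (site v p) (height g h) (inr i) x.
  have [a ai] := vertex_direction n_gt0 v_ext p_int i.
  exact: (dominant_exists (height g h) ai).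
pose w := dual (inr i0) (site v p) (height g h).
exists (cells (inr i0) (site v p) (height g h)), w, h; split; split.
- by rewrite -suppE; exact: cells_decomposition.
- split=> [i|j].
    by have [x xi] := v_dom i; exact: (dominant_vertex (inr i0) xi).
  by have [x xj] := p_dom j; exact: (dominant_vertex (inr i0) xj).
- split; last exact: cells_piecewise_linear.
  move=> t x y; rewrite !inE -suppE => xO yO.
  by apply: dual_convex => //; rewrite ge0 le1.
- move=> i; have [x xi] := v_dom i.
  by rewrite /w (active_dual (dominant_active (inr i0) xi)) opprK.
- move=> j; rewrite -hA -(volume_cellE r0 far M) (cellE _ _ _ i0).
  congr volume; apply: (hull_gradients (i := inl j)).
  + by have [x xj] := p_dom j; exists x; exact: dominant_active.
  + move=> z z0 x xj; have [L jL] := act_bounded r0 far h j.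
    have [l zl] : exists l, z 0 l != 0.
      apply/not_existsP => nz; move/eqP: z0; apply; apply/rowP => l; rewrite mxE.
      by apply/eqP/negPn/negP/nz.
    have zl0 : 0 < `|z 0 l| by rewrite normr_gt0.
    have xL : `|x 0 l| <= L by have := jL _ xj l; rewrite mxE subr0.
    have L0 : 0 <= L by exact: le_trans xL.
    (* This moves coordinate [l] by [L + L + 1], from within [[- L, L]] to outside, so the point
       leaves the cell. *)
    pose t := (L + L + 1) / `|z 0 l|.
    have t0 : 0 <= t by rewrite divr_ge0 // !addr_ge0.
    exists t => //; apply/negP => /jL /(_ l); rewrite !mxE subr0.
    have tz : `|t * z 0 l| = L + L + 1 by rewrite normrM ger0_norm // divfK ?gt_eqF.
    have := ler_normB (x 0 l + t * z 0 l) (x 0 l).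
    by rewrite addrAC subrr add0r tz; lra.
- by rewrite (max_affineE _ _ _ i0) legendre_domain_support.
- move=> y; rewrite (max_affineE _ _ _ i0) -suppE.
  move=> /(sigma_cover (inr i0) (height g h))[x xy].
  by rewrite /w (dual_sigma xy) (legendre_sigma xy).
- exists (energy v g p i0 A M); split => //.
  + exact: (energy_variational A r0 G0 far n_gt0 s_inj).
  + exact: (energy_strictly_convex_admissible A r0 G0 far n_gt0 s_inj).
Qed.
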